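(* Assume that $0\le\rho_x,\rho_y<1$, $-1\le\rho_{xy}\le 1$ and $$2\rho_x^2(1+2|\rho_{xy}|)<1,\qquad 2\rho_y^2(1+2|\rho_{xy}|)<1,\qquad 2\rho_x\rho_y(3\rho_{xy}^2+2|\rho_{xy}|+1)<1 .$$ Then mean-square stability holds for the ADI scheme (defined in the context): for all $h_x,h_y,k>0$ and all $(\xi,\eta)\in[-\pi/h_x,\pi/h_x]\times[-\pi/h_y,\pi/h_y]$ with $(\xi,\eta)\ne(0,0)$, $$\lim_{n\to\infty}\mathbb{E}\big[|X_n(\xi,\eta)|^2\big]=0.$$
   Context: Let $\mu_x,\mu_y\in\mathbb{R}$ and let $i_0,j_0\in\mathbb{Z}$. Grid functions are $V=(V_{i,j})_{i,j\in\mathbb{Z}}$ on a grid with spacings $h_x,h_y>0$, and $k>0$ is the time step. **Difference operators.** $(D_xV)_{i,j}=V_{i+1,j}-V_{i-1,j}$, $(D_yV)_{i,j}=V_{i,j+1}-V_{i,j-1}$, $(D_{xx}V)_{i,j}=V_{i+1,j}-2V_{i,j}+V_{i-1,j}$, $(D_{yy}V)_{i,j}=V_{i,j+1}-2V_{i,j}+V_{i,j-1}$, $(D_{xy}V)_{i,j}=V_{i+1,j+1}-V_{i-1,j+1}-V_{i+1,j-1}+V_{i-1,j-1}$; $D_x^2=D_xD_x$, $D_y^2=D_yD_y$. **Noise.** $\widetilde Z_{n,y}=\rho_{xy}Z_{n,x}+\sqrt{1-\rho_{xy}^2}\,Z_{n,y}$, where $Z_{n,x},Z_{n,y}$, $n\ge0$,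 are independent $N(0,1)$ random variables. **ADI scheme.** $V^0_{i,j}=h_x^{-1}h_y^{-1}$ if $(i,j)=(i_0,j_0)$, $V^0_{i,j}=0$ otherwise, and for $n\ge0$ $$\begin{aligned}&\Big(I+\tfrac{\mu_xk}{2h_x}D_x-\tfrac{k}{2h_x^2}D_{xx}\Big)\Big(I+\tfrac{\mu_yk}{2h_y}D_y-\tfrac{k}{2h_y^2}D_{yy}\Big)V^{n+1}\\&=\Big(I-\tfrac{\sqrt{\rho_xk}Z_{n,x}}{2h_x}D_x-\tfrac{\sqrt{\rho_yk}\widetilde Z_{n,y}}{2h_y}D_y+\tfrac{\rho_xk(Z_{n,x}^2-1)}{8h_x^2}D_x^2+\tfrac{\rho_yk(\widetilde Z_{n,y}^2-1)}{8h_y^2}D_y^2+\tfrac{\sqrt{\rho_x\rho_y}kZ_{n,x}\widetilde Z_{n,y}}{4h_xh_y}D_{xy}\Big)V^n,\end{aligned}$$ where $V^{n+1}$ is the solution in $\ell^2(\mathbb{Z}^2)$. **Fourier coefficients.** $X_n(\xi,\eta)=\widetilde V^n(\xi,\eta)$ denotes the discrete Fourier transform of $V^n$, i.e. $$V^n_{i,j}=\frac1{4\pi^2}\int_{-\pi/h_y}^{\pi/h_y}\int_{-\pi/h_x}^{\pi/h_x}X_n(\xi,\eta)\,e^{\mathrm{i}((i-i_0)\xi h_x+(j-j_0)\eta h_y)}\,\mathrm{d}\xi\,\mathrm{d}\eta,\qquad X_0\equiv1$$ ($\mathrm{i}$ outside the bracket is the imaginary unit). Inserting this into the scheme gives $X_{n+1}(\xi,\eta)=C_n(\xi,\eta)X_n(\xi,\eta)$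 with an explicit random trigonometric factor $C_n$, so $X_n$ is defined pointwise in $(\xi,\eta)$. *)

(* Defs.v *)
From HB Require Import structures.
From mathcomp Require Import all_boot all_order all_algebra.
From mathcomp Require Import all_classical all_reals all_analysis.
From mathcomp Require Import complex.

Set Implicit Arguments.
Unset Strict Implicit.
Unset Printing Implicit Defensive.
Import Order.TTheory GRing.Theory Num.Theory.
Import numFieldNormedType.Exports.

Local Open Scope classical_set_scope.
Local Open Scope ring_scope.

Section Noise.
Context d (Omega : measurableType d) (R : realType) (P : probability Omega R).

Definition mutually_independent (I : eqType) (X : I -> {RV P >-> R}) : Prop :=
  forall (s : seq I) (B : I -> set R),
    uniq s -> (forall i, measurable (B i)) ->
    P (\bigcap_(i in [set` s]) X i @^-1` B i)
      = (\prod_(i <- s) P (X i @^-1` B i))%E.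

(* Restricted to measurable sets: [normal_prob] and [distribution] are also
   functions of non-measurable sets, where their values carry no meaning. *)
Definition standard_normal (Z : {RV P >-> R}) : Prop :=
  forall A : set R, measurable A -> distribution P Z A = normal_prob 0 1 A.

Definition joint_noise (Zx Zy : nat -> {RV P >-> R})
    (i : nat + nat) : {RV P >-> R} :=
  match i with inl n => Zx n | inr n => Zy n end.

Definition iid_standard_normal (Zx Zy : nat -> {RV P >-> R}) : Prop :=
  (forall i, standard_normal (joint_noise Zx Zy i)) /\
  mutually_independent (joint_noise Zx Zy).

End Noise.

Section Scheme.
Variable R : realType.

Definition grid := int -> int -> R.

Implicit Types V : grid.

Definition Dx V : grid := fun i j => V (i + 1) j - V (i - 1) j.
Definition Dy V : grid := fun i j => V i (j + 1) - V i (j - 1).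
Definition Dxx V : grid :=
  fun i j => V (i + 1) j - 2 * V i j + V (i - 1) j.
Definition Dyy V : grid :=
  fun i j => V i (j + 1) - 2 * V i j + V i (j - 1).
Definition Dxy V : grid := fun i j =>
  V (i + 1) (j + 1) - V (i - 1) (j + 1) - V (i + 1) (j - 1)
  + V (i - 1) (j - 1).

Definition implicit_x (mux hx k : R) V : grid := fun i j =>
  V i j + mux * k / (2 * hx) * Dx V i j - k / (2 * hx ^+ 2) * Dxx V i j.

Definition implicit_y (muy hy k : R) V : grid := fun i j =>
  V i j + muy * k / (2 * hy) * Dy V i j - k / (2 * hy ^+ 2) * Dyy V i j.

Definition correlated (rhoxy zx zy : R) : R :=
  rhoxy * zx + Num.sqrt (1 - rhoxy ^+ 2) * zy.

(* Here [zy] is the noise already correlated with [zx]. *)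
Definition explicit_part (rhox rhoy hx hy k zx zy : R) V : grid := fun i j =>
  V i j
  - Num.sqrt (rhox * k) * zx / (2 * hx) * Dx V i j
  - Num.sqrt (rhoy * k) * zy / (2 * hy) * Dy V i j
  + rhox * k * (zx ^+ 2 - 1) / (8 * hx ^+ 2) * Dx (Dx V) i j
  + rhoy * k * (zy ^+ 2 - 1) / (8 * hy ^+ 2) * Dy (Dy V) i j
  + Num.sqrt (rhox * rhoy) * k * zx * zy / (4 * hx * hy) * Dxy V i j.

Definition initial_grid (hx hy : R) (i0 j0 : int) : grid := fun i j =>
  if (i == i0) && (j == j0) then hx^-1 * hy^-1 else 0.

Definition square_summable V : Prop :=
  summable [set: int * int] (fun p : int * int => ((V p.1 p.2) ^+ 2)%:E).

(* One path of the scheme: [zx n] and [zy n] are the values of the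
   independent noises on that path. *)
Definition is_ADI_solution (mux muy rhox rhoy rhoxy hx hy k : R) (i0 j0 : int)
    (zx zy : nat -> R) (V : nat -> grid) : Prop :=
  [/\ V 0%N = initial_grid hx hy i0 j0,
      forall n, square_summable (V n) &
      forall n,
        implicit_x mux hx k (implicit_y muy hy k (V n.+1))
        = explicit_part rhox rhoy hx hy k (zx n)
            (correlated rhoxy (zx n) (zy n)) (V n)].

End Scheme.

Section Fourier.
Variable R : realType.

Definition cintegral (A : set R) (f : R -> R[i]) : R[i] :=
  Complex (\int[lebesgue_measure]_(x in A) complex.Re (f x))
          (\int[lebesgue_measure]_(x in A) complex.Im (f x)).

(* exp (i t) *)
Definition cexpi (t : R) : R[i] := Complex (cos t) (sin t).

Definition frequency_box (hx hy : R) : set (R * R) :=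
  `[- (pi / hx), pi / hx] `*` `[- (pi / hy), pi / hy].

(* The inversion formula determines a Fourier transform only up to a null set
   of frequencies.  Pointwise values are those of the representative that is
   continuous on the closed box; it is unique, and it is the one satisfying
   the multiplier recursion of the scheme at every frequency. *)
Definition is_fourier_transform (hx hy : R) (i0 j0 : int) (V : grid R)
    (X : R -> R -> R[i]) : Prop :=
  [/\ {within frequency_box hx hy,
        continuous (fun z : R * R => complex.Re (X z.1 z.2))},
      {within frequency_box hx hy,
        continuous (fun z : R * R => complex.Im (X z.1 z.2))} &
      forall i j : int,
        real_complex R (V i j)
        = real_complex R (1 / (4 * pi ^+ 2)) *
          cintegral `[- (pi / hy), pi / hy] (fun eta =>
            cintegral `[- (pi / hx), pi / hx] (fun xi =>
              X xi eta *
              cexpi ((i - i0)%:~R * xi * hx + (j - j0)%:~R * eta * hy)))].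

End Fourier.

(* Main.v *)
Require Import Defs.
From HB Require Import structures.
From mathcomp Require Import all_boot all_order all_algebra.
From mathcomp Require Import all_classical all_reals all_analysis.
From mathcomp Require Import complex measurable_realfun ring lra.

Set Implicit Arguments.
Unset Strict Implicit.
Unset Printing Implicit Defensive.
Import Order.TTheory GRing.Theory Num.Theory.
Import numFieldNormedType.Exports.

Local Open Scope classical_set_scope.
Local Open Scope ring_scope.

(** A continuous function on the frequency box is determined by its Fourier
    coefficients, so the scheme forces [A X_{n+1} = C_n X_n] at every
    frequency, where [A] is the symbol of the implicit operators.  With
    [a = sqrt (rhox k) sin (xi hx) / hx], [b] likewise, [c = a^2 + b^2] and
    [S = a Zx + b Z~y], one gets [|C_n|^2 = 1 + c + (c - S^2)^2 / 4].  By
    independence [E |X_n|^2 = (E |C_0|^2 / |A|^2)^n], and since [S] is a centred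
    Gaussian combination of variance [c + 2 a b rhoxy],
    [E |C_0|^2 = 1 + c + c^2/2 + 2 c a b rhoxy + 3 a^2 b^2 rhoxy^2].  In terms of
    [u = k (1 - cos (xi hx)) / hx^2] and [v] likewise, [a^2 <= 2 rhox u] and
    [b^2 <= 2 rhoy v], and the three hypotheses are what makes this smaller than
    [(1 + u)^2 (1 + v)^2 <= |A|^2] as soon as [u + v > 0]. *)

(** * Uniqueness of Fourier coefficients *)

(** The inversion formula sees a transform only through integrals over the box, and continuity on
    the closed box gives no periodicity across opposite edges. Uniqueness is therefore obtained
    around interior points of an interval, endpoints being reached by continuity, and then iterated
    over the two variables. The mean square is computed without conditional expectations: the
    induction concerns integrals of [|X_n|^2] over events about noises of time at least [n].
    Weighting the probability by [|X_n|^2] then still leaves the two noises of time [n] with a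
    product law, up to a constant mass. The mesh ratios are free, so [u] and [v] can be large and
    unrelated. The last inequality is thus proved as a comparison of polynomials in [u] and [v],
    coefficient by coefficient: the three product hypotheses control [u^2], [v^2] and [u v], while
    [rhox, rhoy < 1] controls the linear terms and makes the inequality strict. *)

Section one_dimensional_fourier.
Variable R : realType.
Implicit Types (f g : R -> R).

Lemma continuous_integrable_itv (a b : R) f : continuous f ->
  (@lebesgue_measure R).-integrable `[a, b] (EFin \o f).
Proof.
move=> cf; apply: continuous_compact_integrable; first exact: segment_compact.
exact: continuous_subspaceT.
Qed.

(** On the compact rectangle [[a, b] x [y - 1, y + 1]] the integrand is bounded, and that constant
    serves as the dominating function near [y]. *)
Lemma continuous_param_Rintegral (a b : R) (f : R * R -> R) : continuous f ->
  continuous (fun y => \int[lebesgue_measure]_(x in `[a, b]) f (x, y)).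
Proof.
move=> cf y.
have cfx t : continuous (fun x => f (x, t)).
  move=> x; apply: (@continuous_comp _ _ _ (fun x => (x, t)) f); last exact: cf.
  exact: (@cvg_pair _ _ _ (nbhs x) (nbhs x) (nbhs t) _ _ _ id (cst t) cvg_id (cvg_cst t)).
have cfy x : continuous (fun t => f (x, t)).
  move=> t; apply: (@continuous_comp _ _ _ (fun t => (x, t)) f); last exact: cf.
  exact: (@cvg_pair _ _ _ (nbhs t) (nbhs x) (nbhs t) _ _ _ (cst x) id (cvg_cst x) cvg_id).
have cpt : compact (`[a, b]%classic `*` `[y - 1, y + 1]%classic : set (R * R)).
  by apply: compact_setX; exact: segment_compact.
have /compact_bounded[M [_ hM]] : compact (f @` (`[a, b]%classic `*` `[y - 1, y + 1]%classic)).
  by apply: continuous_compact => //; exact: continuous_subspaceT.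
have yI : y \in (`]y - 1, y + 1[%classic : set R).
  by rewrite inE /= in_itv/= ltrBlDr ltrDl ltr01.
apply: (@continuity_under_integral R _ _ (@lebesgue_measure R)
  (fun t x => f (x, t)) `[a, b]%classic (measurable_itv _) (y - 1) (y + 1)
  _ _ (cst (M + 1))) yI.
- by move=> t _; exact: continuous_integrable_itv.
- by apply: aeW => /= x _ t _; exact: cfy.
- by apply: continuous_integrable_itv => x; exact: cvg_cst.
- move=> t tI; apply: aeW => /= x xab; apply: (hM (M + 1)).
    by rewrite ltrDl.
  by exists (x, t) => //; split => //=; exact: subset_itv_oo_cc.
Qed.

Lemma continuous_cos_affine (a t : R) : continuous (fun x => cos (a * x + t)).
Proof.
move=> x; apply: (@continuous_comp _ _ _ (fun x => a * x + t) (@cos R)).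
  by apply: cvgD; [apply: cvgMr|exact: cvg_cst].
exact: continuous_cos.
Qed.

(** The hypotheses force [d <= pi]. Cosine decreases up to [pi], and the reflection [t -> 2 pi - t]
    handles larger [t], which do occur because two points of an interval of length [2 pi / h] can be
    more than [pi / h] apart. *)
Lemma cos_le_of_far (d t : R) : 0 <= d -> d <= t <= 2 * pi - d ->
  cos t <= cos d.
Proof.
move=> d0 /andP[dt td].
have aux u : d <= u <= pi -> cos u <= cos d.
  move=> /andP[du up]; rewrite le_eqVlt; case: (ltgtP d u) du => // [du|-> _].
    by rewrite ltr_cos ?du ?orbT// in_itv/=; apply/andP; split; lra.
  by rewrite eqxx.
have [tp|pt] := leP t pi; first by rewrite aux// dt.
have -> : cos t = cos (2 * pi - t).
  by rewrite -[LHS]cosN -[LHS]cosD2pi; congr cos; rewrite -mulr_natl; ring.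
by apply: aux; apply/andP; split; lra.
Qed.

Lemma Bernoulli_ge (r : R) n : 0 <= r -> 1 + n%:R * r <= (1 + r) ^+ n.
Proof.
move=> r0; elim: n => [|n IH]; first by rewrite mul0r addr0 expr0.
rewrite exprS -natr1; have := ler_wpM2l (addr_ge0 ler01 r0) IH.
apply: le_trans; have : 0 <= n%:R * r * r by rewrite !mulr_ge0.
by lra.
Qed.

Section uniqueness.
Variables (h : R) (f : R -> R).
Hypothesis h_gt0 : 0 < h.
Hypothesis cf : continuous f.
Local Notation I := (`[- (pi / h), pi / h]%classic : set R).
Local Notation mu := (@lebesgue_measure R).
(** The free phase [t] covers cosines and sines of every integer frequency at once, and it keeps the
    family closed under multiplication by a kernel centred at any point. *)
Hypothesis f_orth : forall (j : int) (t : R),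
  \int[mu]_(x in I) (f x * cos (j%:~R * h * x + t)) = 0.

Let K (c y x : R) := c + cos (h * x - y).

Let cK c y : continuous (K c y).
Proof.
by move=> x; apply: cvgD; [exact: cvg_cst | exact: continuous_cos_affine].
Qed.

Let cKX c y n : continuous (fun x => K c y x ^+ n).
Proof.
move=> x; apply: (@continuous_comp _ _ _ (K c y) (@GRing.exp R ^~ n)).
  exact: cK.
exact: exprn_continuous.
Qed.

Let cint g : continuous g -> mu.-integrable I (EFin \o g).
Proof. exact: continuous_integrable_itv. Qed.

(* [cos v * cos u] is half of [cos (u + v) + cos (u - v)], so multiplying by the
   kernel only shifts the frequency [j]. *)
Lemma orthogonal_kernel_power (c y : R) n (j : int) (t : R) :
  \int[mu]_(x in I) (f x * K c y x ^+ n * cos (j%:~R * h * x + t)) = 0.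
Proof.
elim: n j t => [|n IH] j t.
  by rewrite -[RHS](f_orth j t); apply: eq_Rintegral => x _; rewrite expr0 mulr1.
have cg (i : int) s : continuous (fun x => f x * K c y x ^+ n * cos (i%:~R * h * x + s)).
  move=> x; apply: cvgM; last exact: continuous_cos_affine.
  by apply: cvgM; [exact: cf | exact: cKX].
have trig x : f x * K c y x ^+ n.+1 * cos (j%:~R * h * x + t) =
   c * (f x * K c y x ^+ n * cos (j%:~R * h * x + t)) +
   (2^-1 * (f x * K c y x ^+ n * cos ((j + 1)%:~R * h * x + (t - y))) +
   2^-1 * (f x * K c y x ^+ n * cos ((j - 1)%:~R * h * x + (t + y)))).
  rewrite exprSr {2}/K.
  have -> : (j + 1)%:~R * h * x + (t - y) = (j%:~R * h * x + t) + (h * x - y).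
    by rewrite intrD; ring.
  have -> : (j - 1)%:~R * h * x + (t + y) = (j%:~R * h * x + t) - (h * x - y).
    by rewrite intrB; ring.
  by set v := h * x - y; rewrite (cosB _ v) (cosD _ v); field.
under eq_Rintegral do rewrite trig.
have cZ r g : continuous g -> continuous (fun x => r * g x).
  by move=> cg' x; apply: cvgM; [exact: cvg_cst|exact: cg'].
have cD g1 g2 : continuous g1 -> continuous g2 -> continuous (fun x => g1 x + g2 x).
  by move=> c1 c2 x; apply: cvgD; [exact: c1|exact: c2].
rewrite !RintegralD ?RintegralZl ?IH//; first by rewrite !mulr0 !addr0.
all: by apply: cint; rewrite //; do ?[apply: cD|apply: cZ|apply: cg].
Qed.

(* With [K = 1 - cos (h d) + cos (h (x - x1))], [K^n] stays in [[-1, 1]] away from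
   [x1], is at least 1 within [d] of [x1], and grows geometrically within [d / 2]
   of it, so the integral of [f K^n], which vanishes, would tend to infinity. *)
Lemma orthogonal_not_ge (x1 d e : R) : 0 < d -> 0 < e ->
  - (pi / h) <= x1 - d -> x1 + d <= pi / h ->
  (forall x, `|x - x1| <= d -> e <= f x) -> False.
Proof.
move=> d0 e0 lo hi fe.
have Lh : pi / h * h = pi by rewrite divfK// gt_eqF.
have pi0 := pi_gt0 R.
have L0 : 0 < pi / h by rewrite divr_gt0.
have dL : d <= pi / h by lra.
have hd0 : 0 < h * d by rewrite mulr_gt0.
have hdpi : h * d <= pi by rewrite -Lh mulrC ler_pM2r.
pose c := 1 - cos (h * d); pose y := h * x1.
have KE x : K c y x = c + cos (h * `|x - x1|).
  rewrite /K /y -mulrBr; congr (_ + _).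
  by rewrite -[LHS]cos_norm normrM (gtr0_norm h_gt0).
pose r := cos (h * (d / 2)) - cos (h * d).
have r0 : 0 < r.
  rewrite subr_gt0 ltr_cos ?in_itv/=; first by rewrite ltr_pM2l//; lra.
    by apply/andP; split; nra.
  by rewrite hdpi ltW.
have Kin x : `|x - x1| <= d / 2 -> 1 + r <= K c y x.
  move=> xd; rewrite KE /c /r.
  have : cos (h * (d / 2)) <= cos (h * `|x - x1|).
    have hh : h * `|x - x1| <= h * (d / 2) by rewrite ler_pM2l.
    apply: cos_le_of_far; first by rewrite mulr_ge0// ltW.
    have := mulr_ge0 (ltW h_gt0) (normr_ge0 (x - x1)).
    rewrite hh /=; nra.
  by lra.
have Kmid x : `|x - x1| <= d -> 1 <= K c y x.
  move=> xd; rewrite KE /c.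
  have : cos (h * d) <= cos (h * `|x - x1|).
    have hh : h * `|x - x1| <= h * d by rewrite ler_pM2l.
    apply: cos_le_of_far; first by rewrite mulr_ge0// ltW.
    have := mulr_ge0 (ltW h_gt0) (normr_ge0 (x - x1)).
    rewrite hh /=; nra.
  by lra.
have Kout x : I x -> d <= `|x - x1| -> `|K c y x| <= 1.
  rewrite /= in_itv/= => /andP[x0 x2] xd; rewrite KE /c.
  have : cos (h * `|x - x1|) <= cos (h * d).
    apply: cos_le_of_far; first exact: ltW.
    rewrite ler_pM2l// xd /= -{1}Lh lerBrDr.
    (* The kernel has period [2 pi / h]. Since [[x1 - d, x1 + d]] lies in the interval, [x] also
       stays at distance at least [d] from the periodic copies of the peak. *)
    have : `|x - x1| + d <= 2 * (pi / h).
      by case: (ler0P (x - x1)) xd => _ _; lra.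
    by move/(ler_wpM2l (ltW h_gt0)); lra.
  have := cos_le1 (h * d); have := cos_geN1 (h * d).
  have := cos_geN1 (h * `|x - x1|).
  by rewrite ler_norml => ? ? ? ?; apply/andP; split; lra.
have /compact_bounded[M0 [_ hM]] : compact (f @` I).
  apply: continuous_compact; last exact: segment_compact.
  exact: continuous_subspaceT.
pose M := `|M0| + 1.
have fM x : I x -> `|f x| <= M.
  move=> Ix; apply: (hM M); last by exists x.
  by rewrite (le_lt_trans (ler_norm M0))// ltrDl.
pose J := (`[x1 - d / 2, x1 + d / 2]%classic : set R).
have J_I : J `<=` I.
  by move=> x; rewrite /J/= !in_itv/= => /andP[? ?]; apply/andP; split; lra.
(* Within [d / 2] of [x1] the product grows, between [d / 2] and [d] it is nonnegative, and beyond
   [d] it is at least [- M]. Subtracting [M] everywhere puts the three zones into one formula. *)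
have lb n x : I x ->
    e * (1 + r) ^+ n * \1_J x + - M <= f x * K c y x ^+ n.
  move=> Ix; have M_0 : 0 <= M by rewrite /M addr_ge0.
  have [Jx|nJx] := pselect (J x).
    rewrite indicE mem_set// mulr1.
    have xd : `|x - x1| <= d / 2.
      by move: Jx; rewrite /J/= in_itv/= ler_norml => /andP[? ?]; apply/andP; split; lra.
    have : e * (1 + r) ^+ n <= f x * K c y x ^+ n.
      apply: ler_pM; rewrite ?(ltW e0)//.
        by rewrite exprn_ge0// addr_ge0// ltW.
        by apply: fe; lra.
      by apply: lerXn2r; rewrite ?nnegrE ?Kin//; have := Kin _ xd; lra.
    by lra.
  rewrite indicE memNset// mulr0 add0r.
  have [xd|/ltW dx] := leP `|x - x1| d.
    apply: (@le_trans _ _ 0); first by rewrite oppr_le0.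
    apply: mulr_ge0; first by rewrite (le_trans (ltW e0))// fe.
    by rewrite exprn_ge0// (le_trans ler01)// Kmid.
  have : `|f x * K c y x ^+ n| <= M * 1.
    rewrite normrM normrX ler_pM// ?exprn_ge0// ?fM// exprn_ile1// Kout//.
  by rewrite mulr1 ler_norml => /andP[].
have int0 n : \int[mu]_(x in I) (f x * K c y x ^+ n) = 0.
  rewrite -[RHS](orthogonal_kernel_power c y n 0 0); apply: eq_Rintegral => x _.
  by rewrite !mul0r addr0 cos0 mulr1.
have mJ : measurable J by exact: measurable_itv.
have mI : measurable I by exact: measurable_itv.
have intJ : mu.-integrable I (EFin \o (\1_J : R -> R)).
  by apply: (integrableS measurableT) => //; exact: integrable_indic_itv.
have intM : mu.-integrable I (EFin \o (fun=> - M : R)).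
  by apply: cint => x; exact: cvg_cst.
have key n : e * (1 + r) ^+ n * d <= M * (2 * (pi / h)).
  have intZ : mu.-integrable I (EFin \o (fun x => e * (1 + r) ^+ n * \1_J x)).
    by have := @integrableZl _ _ _ mu I mI (e * (1 + r) ^+ n) _ intJ.
  have : \int[mu]_(x in I) (e * (1 + r) ^+ n * \1_J x + - M) <= 0.
    rewrite -(int0 n); apply: le_Rintegral => //.
      exact: (@integrableD _ _ _ mu I mI _ _ intZ intM).
      by apply: cint => x; apply: cvgM; [exact: cf|exact: cKX].
    exact: lb.
  have muI : fine (mu I) = 2 * (pi / h).
    by rewrite lebesgue_measure_itv/= lte_fin ifT/=; lra.
  have muJ : fine (mu J) = d.
    by rewrite /J lebesgue_measure_itv/= lte_fin ifT/=; lra.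
  have EJ : \int[mu]_(x in I) (\1_J x : R) = d.
    by rewrite /Rintegral integral_indic// (setIidl J_I).
  have ED := @RintegralD _ _ _ mu I _ _ mI intZ intM.
  have EZ := @RintegralZl _ _ _ mu I _ (e * (1 + r) ^+ n) mI intJ.
  have EC := @Rintegral_cst _ _ _ mu I mI (- M).
  move=> int_le0; suff : e * (1 + r) ^+ n * d + - M * (2 * (pi / h)) <= 0.
    by rewrite mulNr subr_le0.
  apply: le_trans int_le0; rewrite le_eqVlt; apply/orP; left; apply/eqP.
  symmetry; apply: (etrans ED); congr (_ + _).
    by apply: (etrans EZ); rewrite EJ.
  by apply: (etrans EC); rewrite muI.
have ed0 : 0 < e * d * r by rewrite !mulr_gt0.
(* By Bernoulli, [key n] bounds [e d (1 + n r)] by a constant independent of [n]; this [n] exceeds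
   what that allows. *)
have [n hn] : exists n : nat, M * (2 * (pi / h)) / (e * d * r) < n%:R.
  exists (Num.truncn (M * (2 * (pi / h)) / (e * d * r))).+1.
  exact: truncnS_gt.
move: hn; rewrite ltr_pdivrMr// => hn.
have := Bernoulli_ge n (ltW r0).
have ed : 0 < e * d by rewrite mulr_gt0.
move/(ler_wpM2l (ltW ed)) => h1; have h2 := key n.
by nra.
Qed.

End uniqueness.
End one_dimensional_fourier.

Section complex_fourier.
Variable R : realType.
Local Notation mu := (@lebesgue_measure R).

(** A point with [f x > 0] may be an endpoint, where no symmetric window fits. It is first moved
    inward to [(1 - t) x], around which a window of radius [t (pi / h) / 2] stays in the interval
    and, for small [t], in the region where [f > f x / 2]. *)
Lemma trig_orthogonal_le0 (h : R) (f : R -> R) : 0 < h -> continuous f ->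
  (forall (j : int) (t : R),
    \int[mu]_(x in `[- (pi / h), pi / h]) (f x * cos (j%:~R * h * x + t)) = 0) ->
  forall x, `|x| <= pi / h -> f x <= 0.
Proof.
move=> h0 cf orth x xL; rewrite leNgt; apply/negP => fx.
have L0 : 0 < pi / h by rewrite divr_gt0// pi_gt0.
have fx2 : 0 < f x / 2 by rewrite divr_gt0.
have /nbhs_ballP[d /= d0 hd] : \forall y \near x, `|f x - f y| < f x / 2.
  by move/cvgrPdist_lt : (cf x); apply.
have dL : 0 < d / (2 * (pi / h)) by rewrite divr_gt0// mulr_gt0.
(* Chosen so that [t (pi / h) <= d / 2]: the inward move and the window radius together amount to at
   most [3 d / 4]. *)
pose t := Num.min 2^-1 (d / (2 * (pi / h))).
have [t0 t1 t2] : [/\ 0 < t, t <= 2^-1 & t * (pi / h) <= d / 2].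
  rewrite /t; split; rewrite ?lt_min ?ge_min ?lexx ?dL ?andbT ?invr_gt0//.
  have -> : d / 2 = (d / (2 * (pi / h))) * (pi / h).
    by move: (pi / h) L0 => L L0; field; rewrite gt_eqF.
  by rewrite ler_pM2r// ge_min lexx orbT.
have tL : 0 < t * (pi / h) by rewrite mulr_gt0.
move: xL; rewrite ler_norml => /andP[xlo xhi].
have tx : `|t * x| <= t * (pi / h).
  by rewrite normrM (gtr0_norm t0) ler_pM2l// ler_norml xlo.
have tx1 : (1 - t) * x <= (1 - t) * (pi / h) by rewrite ler_wpM2l//; lra.
have tx2 : (1 - t) * (- x) <= (1 - t) * (pi / h) by rewrite ler_wpM2l//; lra.
apply: (@orthogonal_not_ge R h f h0 cf orth ((1 - t) * x) (t * (pi / h) / 2) (f x / 2)).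
- by rewrite divr_gt0.
- by rewrite divr_gt0.
- by lra.
- by lra.
- move=> y yx; have : `|f x - f y| < f x / 2.
    apply: hd; rewrite /ball/=.
    have -> : x - y = ((1 - t) * x - y) + t * x by ring.
    rewrite (le_lt_trans (ler_normD _ _))// distrC.
    by lra.
  rewrite ltr_norml => /andP[_]; lra.
Qed.

Lemma trig_orthogonal_eq0 (h : R) (f : R -> R) : 0 < h -> continuous f ->
  (forall (j : int) (t : R),
    \int[mu]_(x in `[- (pi / h), pi / h]) (f x * cos (j%:~R * h * x + t)) = 0) ->
  forall x, `|x| <= pi / h -> f x = 0.
Proof.
move=> h0 cf orth x xL; apply/eqP; rewrite eq_le (trig_orthogonal_le0 h0 cf orth)//=.
rewrite -oppr_le0.
have cNf : continuous (fun x => - f x) by move=> y; apply: cvgN; exact: cf.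
apply: (trig_orthogonal_le0 (f := fun x => - f x) h0 cNf) => // j t.
under eq_Rintegral do rewrite mulNr -mulN1r.
rewrite RintegralZl//; first by rewrite orth mulr0.
apply: continuous_integrable_itv => y; apply: cvgM; first exact: cf.
exact: continuous_cos_affine.
Qed.

Local Notation C := R[i].
Local Notation Re := complex.Re.
Local Notation Im := complex.Im.

Lemma complexReM (x y : C) : Re (x * y) = Re x * Re y - Im x * Im y.
Proof. by case: x y => [a b] [c d]. Qed.

Lemma complexImM (x y : C) : Im (x * y) = Re x * Im y + Im x * Re y.
Proof. by case: x y => [a b] [c d]. Qed.

Lemma complexReD (x y : C) : Re (x + y) = Re x + Re y.
Proof. by case: x y => [a b] [c d]. Qed.

Lemma complexImD (x y : C) : Im (x + y) = Im x + Im y.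
Proof. by case: x y => [a b] [c d]. Qed.

Lemma complex_ext (x y : C) : Re x = Re y -> Im x = Im y -> x = y.
Proof. by case: x y => [a b] [c d] /= -> ->. Qed.

Lemma cexpiD (s t : R) : cexpi (s + t) = cexpi s * cexpi t.
Proof.
by apply: complex_ext; rewrite ?complexReM ?complexImM /=; [rewrite cosD | rewrite sinD addrC].
Qed.

Definition ccontinuous (T : topologicalType) (F : T -> C) : Prop :=
  continuous (fun x => Re (F x)) /\ continuous (fun x => Im (F x)).

Lemma ccontinuousD (T : topologicalType) (F G : T -> C) :
  ccontinuous F -> ccontinuous G -> ccontinuous (fun x => F x + G x).
Proof.
move=> [Fr Fi] [Gr Gi]; split => x; under eq_fun do rewrite ?complexReD ?complexImD.
  by apply: cvgD; [exact: Fr|exact: Gr].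
by apply: cvgD; [exact: Fi|exact: Gi].
Qed.

Lemma ccontinuousM (T : topologicalType) (F G : T -> C) :
  ccontinuous F -> ccontinuous G -> ccontinuous (fun x => F x * G x).
Proof.
move=> [Fr Fi] [Gr Gi]; split => x; under eq_fun do rewrite ?complexReM ?complexImM.
  by apply: cvgB; apply: cvgM; [exact: Fr|exact: Gr|exact: Fi|exact: Gi].
by apply: cvgD; apply: cvgM; [exact: Fr|exact: Gi|exact: Fi|exact: Gr].
Qed.

Lemma ccontinuous_cst (T : topologicalType) (z : C) :
  ccontinuous (fun _ : T => z).
Proof. by split => x; exact: cvg_cst. Qed.

Lemma ccontinuous_cexpi (T : topologicalType) (g : T -> R) : continuous g ->
  ccontinuous (fun x => cexpi (g x)).
Proof.
move=> cg; split => x /=.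
  by apply: (@continuous_comp _ _ _ g (@cos R)); [exact: cg|exact: continuous_cos].
by apply: (@continuous_comp _ _ _ g (@sin R)); [exact: cg|exact: continuous_sin].
Qed.

Lemma ccontinuous_comp (T U : topologicalType) (g : T -> U) (F : U -> C) :
  continuous g -> ccontinuous F -> ccontinuous (fun x => F (g x)).
Proof.
move=> cg [Fr Fi]; split => x.
  by apply: (@continuous_comp _ _ _ g (fun x => Re (F x))); [exact: cg|exact: Fr].
by apply: (@continuous_comp _ _ _ g (fun x => Im (F x))); [exact: cg|exact: Fi].
Qed.

Lemma eq_cintegral (A : set R) (f g : R -> C) : (forall x, A x -> f x = g x) ->
  cintegral A f = cintegral A g.
Proof.
by move=> fg; congr Complex; apply: eq_Rintegral => x /set_mem Ax; rewrite fg.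
Qed.

Lemma cintegralD (a b : R) (f g : R -> C) : ccontinuous f -> ccontinuous g ->
  cintegral `[a, b] (fun x => f x + g x) =
  cintegral `[a, b] f + cintegral `[a, b] g.
Proof.
move=> [fr fi] [gr gi]; apply: complex_ext; rewrite ?complexReD ?complexImD /=.
  under eq_Rintegral do rewrite complexReD.
  by rewrite RintegralD//; exact: continuous_integrable_itv.
under eq_Rintegral do rewrite complexImD.
by rewrite RintegralD//; exact: continuous_integrable_itv.
Qed.

Lemma cintegralZ (a b : R) (z : C) (f : R -> C) : ccontinuous f ->
  cintegral `[a, b] (fun x => z * f x) = z * cintegral `[a, b] f.
Proof.
have cZ r (g : R -> R) : continuous g -> continuous (fun x => r * g x).
  by move=> cg x; apply: cvgM; [exact: cvg_cst|exact: cg].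
move=> [fr fi]; apply: complex_ext; rewrite ?complexReM ?complexImM /=.
  under eq_Rintegral do rewrite complexReM.
  by rewrite RintegralB ?RintegralZl//;
     apply: continuous_integrable_itv => //; exact: cZ.
under eq_Rintegral do rewrite complexImM.
by rewrite RintegralD ?RintegralZl//;
   apply: continuous_integrable_itv => //; exact: cZ.
Qed.

Lemma ccontinuous_param_cintegral (a b : R) (F : R * R -> C) : ccontinuous F ->
  ccontinuous (fun y => cintegral `[a, b] (fun x => F (x, y))).
Proof.
move=> [Fr Fi]; split => /=.
  exact: (@continuous_param_Rintegral R a b (fun z => Re (F z))).
exact: (@continuous_param_Rintegral R a b (fun z => Im (F z))).
Qed.

(** Each complex coefficient mixes the real and imaginary parts of [f]. Combining the frequencies
    [j] and [- j] separates them, because cosine is even and sine is odd; the addition formula then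
    supplies the arbitrary phase needed in the real case. *)
Lemma cfourier_eq0 (h : R) (f : R -> C) : 0 < h -> ccontinuous f ->
  (forall j : int,
    cintegral `[- (pi / h), pi / h] (fun x => f x * cexpi (j%:~R * x * h)) = 0) ->
  forall x, `|x| <= pi / h -> f x = 0.
Proof.
move=> h0 [cr ci] H.
pose I : set R := `[- (pi / h), pi / h]%classic.
have mI : measurable I by exact: measurable_itv.
have cc (j : int) : continuous (fun x : R => cos (j%:~R * x * h)).
  rewrite (_ : (fun x : R => _) = (fun x => cos (j%:~R * h * x + 0))).
    exact: continuous_cos_affine.
  by apply/funext => x; rewrite addr0 mulrAC.
have cs (j : int) : continuous (fun x : R => sin (j%:~R * x * h)).
  rewrite (_ : (fun x : R => _) = (fun x => cos (j%:~R * h * x + - (pi / 2)))).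
    exact: continuous_cos_affine.
  by apply/funext => x; rewrite cosBpihalf mulrAC.
have iM (g k : R -> R) : continuous g -> continuous k ->
    mu.-integrable I (EFin \o (fun x => g x * k x)).
  move=> cg ck; apply: continuous_integrable_itv => x.
  by apply: cvgM; [exact: cg|exact: ck].
have key (j : int) :
  [/\ \int[mu]_(x in I) (Re (f x) * cos (j%:~R * x * h)) = 0,
   \int[mu]_(x in I) (Re (f x) * sin (j%:~R * x * h)) = 0,
   \int[mu]_(x in I) (Im (f x) * cos (j%:~R * x * h)) = 0 &
   \int[mu]_(x in I) (Im (f x) * sin (j%:~R * x * h)) = 0].
  have E1 i : \int[mu]_(x in I) (Re (f x) * cos (i%:~R * x * h)) -
      \int[mu]_(x in I) (Im (f x) * sin (i%:~R * x * h)) = 0.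
    rewrite -RintegralB//; [|exact: iM|exact: iM].
    have := congr1 (@complex.Re R) (H i); rewrite /= => Hi; rewrite -[RHS]Hi.
    by apply: eq_Rintegral => x _; rewrite complexReM.
  have E2 i : \int[mu]_(x in I) (Re (f x) * sin (i%:~R * x * h)) +
      \int[mu]_(x in I) (Im (f x) * cos (i%:~R * x * h)) = 0.
    rewrite -RintegralD//; [|exact: iM|exact: iM].
    have := congr1 (@complex.Im R) (H i); rewrite /= => Hi; rewrite -[RHS]Hi.
    by apply: eq_Rintegral => x _; rewrite complexImM.
  have sN (g : R -> R) : continuous g ->
      \int[mu]_(x in I) (g x * sin ((- j)%:~R * x * h)) =
      - \int[mu]_(x in I) (g x * sin (j%:~R * x * h)).
    move=> cg; under eq_Rintegral do rewrite intrN !mulNr sinN mulrN -mulN1r.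
    by rewrite RintegralZl ?mulN1r//; exact: iM.
  have cN (g : R -> R) :
      \int[mu]_(x in I) (g x * cos ((- j)%:~R * x * h)) =
      \int[mu]_(x in I) (g x * cos (j%:~R * x * h)).
    by under eq_Rintegral do rewrite intrN !mulNr cosN.
  have := E1 (- j); have := E2 (- j); rewrite !sN// !cN => e3 e4.
  have e1 := E1 j; have e2 := E2 j.
  by split; lra.
have orth (g : R -> R) : continuous g ->
  (forall j : int, \int[mu]_(x in I) (g x * cos (j%:~R * x * h)) = 0) ->
  (forall j : int, \int[mu]_(x in I) (g x * sin (j%:~R * x * h)) = 0) ->
  forall (j : int) (t : R), \int[mu]_(x in I) (g x * cos (j%:~R * h * x + t)) = 0.
  move=> cg gc gs j t.
  have E x : g x * cos (j%:~R * h * x + t) =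
     cos t * (g x * cos (j%:~R * x * h)) - sin t * (g x * sin (j%:~R * x * h)).
    by rewrite cosD (mulrAC _ h x); ring.
  under eq_Rintegral do rewrite E.
  rewrite RintegralB//; first rewrite !RintegralZl ?gc ?gs//.
  - by rewrite !mulr0 subr0.
  - exact: iM.
  - exact: iM.
  - apply: continuous_integrable_itv => x; apply: cvgM; first exact: cvg_cst.
    by apply: cvgM; [exact: cg|exact: cc].
  - apply: continuous_integrable_itv => x; apply: cvgM; first exact: cvg_cst.
    by apply: cvgM; [exact: cg|exact: cs].
move=> x xL; apply: complex_ext => /=.
  apply: (trig_orthogonal_eq0 h0 cr _ xL); apply: orth => // j; by have [] := key j.
apply: (trig_orthogonal_eq0 h0 ci _ xL); apply: orth => // j; by have [] := key j.
Qed.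

End complex_fourier.

(** * Symbols of the difference operators *)

Section scheme_symbols.
Variable R : realType.
Local Notation C := R[i].
Variables (hx hy : R).
Hypotheses (hx0 : 0 < hx) (hy0 : 0 < hy).
Local Notation Re := complex.Re.
Local Notation Im := complex.Im.

Definition character2 (a b : int) (z : R * R) : C :=
  cexpi (a%:~R * z.1 * hx + b%:~R * z.2 * hy).

Lemma ccontinuous_character2 a b : ccontinuous (character2 a b).
Proof.
apply: ccontinuous_cexpi => z; apply: cvgD.
  by apply: cvgMl; apply: cvgMr; exact: cvg_fst.
by apply: cvgMl; apply: cvgMr; exact: cvg_snd.
Qed.

Definition fourier_coef (F : R * R -> C) (a b : int) : C :=
  cintegral `[- (pi / hy), pi / hy] (fun eta =>
    cintegral `[- (pi / hx), pi / hx] (fun xi =>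
      F (xi, eta) * character2 a b (xi, eta))).

Lemma ccontinuous_slice (F : R * R -> C) y : ccontinuous F ->
  ccontinuous (fun x => F (x, y)).
Proof.
apply: ccontinuous_comp => x.
exact: (@cvg_pair _ _ _ (nbhs x) (nbhs x) (nbhs y) _ _ _ id (cst y) cvg_id (cvg_cst y)).
Qed.

Lemma fourier_coefD F G a b : ccontinuous F -> ccontinuous G ->
  fourier_coef (fun z => F z + G z) a b = fourier_coef F a b + fourier_coef G a b.
Proof.
move=> cF cG; have cE := ccontinuous_character2 a b.
have cFE := ccontinuousM cF cE; have cGE := ccontinuousM cG cE.
rewrite /fourier_coef -cintegralD;
  [|exact: ccontinuous_param_cintegral cFE|exact: ccontinuous_param_cintegral cGE].
apply: eq_cintegral => y _; rewrite -cintegralD.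
- by apply: eq_cintegral => x _; rewrite mulrDl.
- exact: ccontinuous_slice cFE.
- exact: ccontinuous_slice cGE.
Qed.

Lemma fourier_coefZ w F a b : ccontinuous F ->
  fourier_coef (fun z => w * F z) a b = w * fourier_coef F a b.
Proof.
move=> cF; have cFE := ccontinuousM cF (ccontinuous_character2 a b).
rewrite /fourier_coef -cintegralZ; last exact: ccontinuous_param_cintegral cFE.
apply: eq_cintegral => y _; rewrite -cintegralZ; last exact: ccontinuous_slice cFE.
by apply: eq_cintegral => x _; rewrite mulrA.
Qed.

Lemma fourier_coef_shift F a b p q :
  fourier_coef (fun z => character2 p q z * F z) a b = fourier_coef F (a + p) (b + q).
Proof.
apply: eq_cintegral => y _; apply: eq_cintegral => x _.
rewrite mulrAC mulrC; congr (_ * _); rewrite /character2 /= -cexpiD; congr cexpi.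
by rewrite !intrD; ring.
Qed.

(** One-dimensional uniqueness is used twice, with no exchange of integrals: for each [a] the inner
    integral is a continuous function of [eta] with vanishing coefficients, hence zero on the
    interval; letting [a] vary then kills [F (_, eta)]. *)
Lemma fourier_coef_eq0 F : ccontinuous F ->
  (forall a b, fourier_coef F a b = 0) ->
  forall xi eta, frequency_box hx hy (xi, eta) -> F (xi, eta) = 0.
Proof.
move=> cF H xi eta []; rewrite /= !in_itv/= -!ler_norml => hxi heta.
have cFa (a : int) : ccontinuous (fun z => F z * cexpi (a%:~R * z.1 * hx)).
  apply: ccontinuousM => //; apply: ccontinuous_cexpi => z.
  by apply: cvgMl; apply: cvgMr; exact: cvg_fst.
apply: (cfourier_eq0 (f := fun x => F (x, eta)) hx0 _ _ hxi).
  exact: ccontinuous_slice.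
move=> a.
apply: (cfourier_eq0 (f := fun y => cintegral `[- (pi / hx), pi / hx]
  (fun x => F (x, y) * cexpi (a%:~R * x * hx))) hy0 _ _ heta).
  exact: ccontinuous_param_cintegral (cFa a).
move=> b; rewrite -[RHS](H a b); apply: eq_cintegral => y _.
rewrite mulrC -cintegralZ; last exact: ccontinuous_slice (cFa a).
by apply: eq_cintegral => x _; rewrite /character2/= cexpiD; ring.
Qed.

Variables (i0 j0 : int).
Implicit Types (V W : grid R) (F G : R * R -> C).

(** Continuity is asked on the whole plane, so [F] is a continuous extension of a transform; only
    its values on the box are determined by [V]. *)
Definition represents V F : Prop :=
  ccontinuous F /\ forall i j : int, real_complex R (V i j) =
    real_complex R (1 / (4 * pi ^+ 2)) * fourier_coef F (i - i0) (j - j0).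

Lemma represents_uniq V F G : represents V F -> represents V G ->
  forall xi eta, frequency_box hx hy (xi, eta) -> F (xi, eta) = G (xi, eta).
Proof.
move=> [cF VF] [cG VG] xi eta box; apply/eqP; rewrite -subr_eq0; apply/eqP.
have cNG : ccontinuous (fun z => -1 * G z).
  by apply: ccontinuousM => //; exact: ccontinuous_cst.
rewrite -mulN1r; apply: (fourier_coef_eq0 (F := fun z => F z + -1 * G z)) => //.
  exact: ccontinuousD.
move=> a b; rewrite fourier_coefD// fourier_coefZ// mulN1r.
have := VF (a + i0) (b + j0); rewrite (VG (a + i0) (b + j0)) !addrK.
have nz : real_complex R (1 / (4 * pi ^+ 2)) != 0.
  rewrite fmorph_eq0 mulf_neq0 ?oner_eq0// invr_eq0 mulf_neq0 ?expf_neq0//.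
  by rewrite gt_eqF// pi_gt0.
by move/(mulfI nz) => ->; rewrite subrr.
Qed.

(** Every operator of the scheme is a linear combination of shifts, so this rule and
    [represents_shift] produce all the symbols. *)
Lemma represents_add_scale V W F G (r : R) : represents V F -> represents W G ->
  represents (fun i j => V i j + r * W i j) (fun z => F z + real_complex R r * G z).
Proof.
move=> [cF VF] [cG WG].
have crG : ccontinuous (fun z => real_complex R r * G z).
  by apply: ccontinuousM => //; exact: ccontinuous_cst.
split; first exact: ccontinuousD.
move=> i j; rewrite fourier_coefD// fourier_coefZ//.
have -> : real_complex R (V i j + r * W i j) =
    real_complex R (V i j) + real_complex R r * real_complex R (W i j).
  by apply: complex_ext; rewrite !(complexReD, complexImD, complexReM, complexImM) /=; ring.
by rewrite VF WG; ring.
Qed.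

Lemma represents_shift V F p q : represents V F ->
  represents (fun i j => V (i + p) (j + q)) (fun z => character2 p q z * F z).
Proof.
move=> [cF VF]; split.
  by apply: ccontinuousM => //; exact: ccontinuous_character2.
by move=> i j; rewrite fourier_coef_shift VF addrAC (addrAC j).
Qed.

Lemma represents_ext V W F G : represents V F -> V = W -> F =1 G ->
  represents W G.
Proof. by move=> VF <- /funext <-. Qed.

Lemma represents_Dx V F : represents V F ->
  represents (Dx V) (fun z => Complex 0 (2 * sin (z.1 * hx)) * F z).
Proof.
move=> VF.
apply: (represents_ext (represents_add_scale (-1)
  (represents_shift 1 0 VF) (represents_shift (-1) 0 VF))).
  by apply/funext => i; apply/funext => j; rewrite /Dx !addr0 mulN1r.
move=> z; apply: complex_ext;
  rewrite !(complexReM, complexImM, complexReD, complexImD) /=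
    !(mulNr, mul1r, mul0r, addr0, cosN, sinN); ring.
Qed.

Lemma represents_Dy V F : represents V F ->
  represents (Dy V) (fun z => Complex 0 (2 * sin (z.2 * hy)) * F z).
Proof.
move=> VF.
apply: (represents_ext (represents_add_scale (-1)
  (represents_shift 0 1 VF) (represents_shift 0 (-1) VF))).
  by apply/funext => i; apply/funext => j; rewrite /Dy !addr0 mulN1r.
move=> z; apply: complex_ext;
  rewrite !(complexReM, complexImM, complexReD, complexImD) /=
    !(mulNr, mul1r, mul0r, add0r, cosN, sinN); ring.
Qed.

Lemma represents_Dxx V F : represents V F ->
  represents (Dxx V) (fun z => Complex (2 * cos (z.1 * hx) - 2) 0 * F z).
Proof.
move=> VF.
apply: (represents_ext (represents_add_scale (-2) (represents_add_scale 1
  (represents_shift 1 0 VF) (represents_shift (-1) 0 VF)) VF)).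
  by apply/funext => i; apply/funext => j; rewrite /Dxx !addr0; ring.
move=> z; apply: complex_ext;
  rewrite !(complexReM, complexImM, complexReD, complexImD) /=
    !(mulNr, mul1r, mul0r, addr0, cosN, sinN); ring.
Qed.

Lemma represents_Dyy V F : represents V F ->
  represents (Dyy V) (fun z => Complex (2 * cos (z.2 * hy) - 2) 0 * F z).
Proof.
move=> VF.
apply: (represents_ext (represents_add_scale (-2) (represents_add_scale 1
  (represents_shift 0 1 VF) (represents_shift 0 (-1) VF)) VF)).
  by apply/funext => i; apply/funext => j; rewrite /Dyy !addr0; ring.
move=> z; apply: complex_ext;
  rewrite !(complexReM, complexImM, complexReD, complexImD) /=
    !(mulNr, mul1r, mul0r, add0r, cosN, sinN); ring.
Qed.

Lemma Dxy_comp V : Dxy V = Dx (Dy V).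
Proof. by apply/funext => i; apply/funext => j; rewrite /Dxy /Dx /Dy; ring. Qed.

Definition implicit_symbol (mu h k t : R) : C :=
  Complex (1 + k / h ^+ 2 * (1 - cos (t * h))) (mu * k / h * sin (t * h)).

Lemma represents_implicit_x mux k V F : represents V F ->
  represents (implicit_x mux hx k V) (fun z => implicit_symbol mux hx k z.1 * F z).
Proof.
move=> VF; have hx_neq0 : hx != 0 by rewrite gt_eqF.
apply: (represents_ext (represents_add_scale (- (k / (2 * hx ^+ 2)))
  (represents_add_scale (mux * k / (2 * hx)) VF (represents_Dx VF))
  (represents_Dxx VF))).
  by apply/funext => i; apply/funext => j; rewrite /implicit_x; ring.
by move=> z; apply: complex_ext;
  rewrite !(complexReM, complexImM, complexReD, complexImD) /=; field.
Qed.

Lemma represents_implicit_y muy k V F : represents V F ->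
  represents (implicit_y muy hy k V) (fun z => implicit_symbol muy hy k z.2 * F z).
Proof.
move=> VF; have hy_neq0 : hy != 0 by rewrite gt_eqF.
apply: (represents_ext (represents_add_scale (- (k / (2 * hy ^+ 2)))
  (represents_add_scale (muy * k / (2 * hy)) VF (represents_Dy VF))
  (represents_Dyy VF))).
  by apply/funext => i; apply/funext => j; rewrite /implicit_y; ring.
by move=> z; apply: complex_ext;
  rewrite !(complexReM, complexImM, complexReD, complexImD) /=; field.
Qed.

Definition explicit_symbol (rhox rhoy k zx zy xi eta : R) : C :=
  let sx := sin (xi * hx) / hx in
  let sy := sin (eta * hy) / hy in
  Complex (1 - rhox * k * (zx ^+ 2 - 1) / 2 * sx ^+ 2
             - rhoy * k * (zy ^+ 2 - 1) / 2 * sy ^+ 2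
             - Num.sqrt (rhox * rhoy) * k * zx * zy * sx * sy)
    (- (Num.sqrt (rhox * k) * zx * sx + Num.sqrt (rhoy * k) * zy * sy)).

Lemma represents_explicit_part rhox rhoy k zx zy V F : represents V F ->
  represents (explicit_part rhox rhoy hx hy k zx zy V)
    (fun z => explicit_symbol rhox rhoy k zx zy z.1 z.2 * F z).
Proof.
move=> VF; have hx_neq0 : hx != 0 by rewrite gt_eqF.
have hy_neq0 : hy != 0 by rewrite gt_eqF.
apply: (represents_ext
  (represents_add_scale (Num.sqrt (rhox * rhoy) * k * zx * zy / (4 * hx * hy))
  (represents_add_scale (rhoy * k * (zy ^+ 2 - 1) / (8 * hy ^+ 2))
  (represents_add_scale (rhox * k * (zx ^+ 2 - 1) / (8 * hx ^+ 2))
  (represents_add_scale (- (Num.sqrt (rhoy * k) * zy / (2 * hy)))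
  (represents_add_scale (- (Num.sqrt (rhox * k) * zx / (2 * hx))) VF
    (represents_Dx VF)) (represents_Dy VF))
    (represents_Dx (represents_Dx VF))) (represents_Dy (represents_Dy VF)))
    (represents_Dx (represents_Dy VF)))).
  by apply/funext => i; apply/funext => j; rewrite /explicit_part Dxy_comp; ring.
by move=> z; apply: complex_ext;
  rewrite !(complexReM, complexImM, complexReD, complexImD) /=; field; rewrite ?hx_neq0 ?hy_neq0.
Qed.

(* Precomposing with [clamp] extends a function continuous on the closed box only
   to one continuous everywhere, without changing its Fourier coefficients. *)
Definition clamp (L x : R) : R := Num.max (- L) (Num.min x L).

Lemma clamp_id L x : - L <= x <= L -> clamp L x = x.
Proof. by move=> /andP[lo hi]; rewrite /clamp min_l// max_r. Qed.

Lemma clamp_in L x : 0 <= L -> - L <= clamp L x <= L.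
Proof.
move=> L0; rewrite /clamp le_max lexx/= ge_max ge_min lexx orbT andbT.
by rewrite (le_trans _ L0)// oppr_le0.
Qed.

Lemma continuous_clamp L : continuous (clamp L).
Proof.
move=> x; apply: (@continuous_max _ _ (cst (- L)) (fun y => Num.min y L)).
  exact: cvg_cst.
by apply: (@continuous_min _ _ id (cst L)); [exact: cvg_id|exact: cvg_cst].
Qed.

Lemma continuous_box_clamp (g : R * R -> R) :
  {within frequency_box hx hy, continuous g} ->
  continuous (fun z => g (clamp (pi / hx) z.1, clamp (pi / hy) z.2)).
Proof.
move=> /subspace_continuousP cg z.
pose cl (z : R * R) := (clamp (pi / hx) z.1, clamp (pi / hy) z.2).
have cl_in y : frequency_box hx hy (cl y).
  by split; rewrite /= in_itv/= clamp_in// divr_ge0 ?pi_ge0// ltW.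
have ccl : cl y @[y --> z] --> cl z.
  apply: (@cvg_pair _ _ _ (nbhs z) (nbhs (clamp (pi / hx) z.1))
    (nbhs (clamp (pi / hy) z.2)) _ _ _
    (fun y => clamp (pi / hx) y.1) (fun y => clamp (pi / hy) y.2)).
    by apply: (continuous_comp (f := fst)); [exact: cvg_fst|exact: continuous_clamp].
  by apply: (continuous_comp (f := snd)); [exact: cvg_snd|exact: continuous_clamp].
move=> U /(cg _ (cl_in z)) /= gU.
have := ccl _ gU; rewrite /nbhs/=; apply: filterS => y /= h.
by apply: h; exact: cl_in.
Qed.

Lemma represents_fourier_transform V (X : R -> R -> C) :
  is_fourier_transform hx hy i0 j0 V X ->
  represents V (fun z => X (clamp (pi / hx) z.1) (clamp (pi / hy) z.2)).
Proof.
move=> [cr ci VX]; split.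
  by split; [have := continuous_box_clamp cr | have := continuous_box_clamp ci].
move=> i j; rewrite VX; congr (_ * _).
apply: eq_cintegral => y; rewrite /= in_itv/= => yin.
apply: eq_cintegral => x; rewrite /= in_itv/= => xin.
by rewrite !clamp_id.
Qed.

(** The two sides of the scheme are the same grid function, so both products represent it and
    uniqueness equates them on the box, edges included. The implicit factors stay on the left, so no
    complex inverse appears; the division is made later, between squared moduli. *)
Lemma multiplier_recursion mux muy rhox rhoy k zx zy V W (X Y : R -> R -> C) :
  is_fourier_transform hx hy i0 j0 V X ->
  is_fourier_transform hx hy i0 j0 W Y ->
  implicit_x mux hx k (implicit_y muy hy k W)
    = explicit_part rhox rhoy hx hy k zx zy V ->
  forall xi eta, frequency_box hx hy (xi, eta) ->
  implicit_symbol mux hx k xi * (implicit_symbol muy hy k eta * Y xi eta)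
    = explicit_symbol rhox rhoy k zx zy xi eta * X xi eta.
Proof.
move=> /represents_fourier_transform VX /represents_fourier_transform WY VW.
move=> xi eta box.
have := represents_explicit_part rhox rhoy k zx zy VX; rewrite -VW => EX.
have IY := represents_implicit_x mux k (represents_implicit_y muy k WY).
have := represents_uniq IY EX box; case: box => /=; rewrite !in_itv/= => hxi heta.
by rewrite !clamp_id.
Qed.

End scheme_symbols.

(** * Integration against pushed-forward densities and Gaussian moments *)

Section density.
Local Open Scope ereal_scope.
Context d d' (T : measurableType d) (T' : measurableType d') (R : realType).
Variables (mu : {measure set T -> \bar R}) (m : {measure set T' -> \bar R}).
Variables (phi : T -> T') (h : T -> R).
Hypothesis mphi : measurable_fun [set: T] phi.
Hypothesis mh : measurable_fun [set: T] h.
Hypothesis h0 : forall x, (0 <= h x)%R.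
Hypothesis mE : forall A, measurable A ->
  m A = \int[mu]_(x in phi @^-1` A) (h x)%:E.
Import HBNNSimple.

Lemma integral_pushforward_density_nnsfun (g : {nnsfun T' >-> R}) :
  \int[m]_y (g y)%:E = \int[mu]_x ((g (phi x))%:E * (h x)%:E).
Proof.
have mg k : measurable (g @^-1` [set k]) by exact: measurable_sfunP.
transitivity (\sum_(k \in range g)
    \int[mu]_x ((k * \1_(g @^-1` [set k]) (phi x))%:E * (h x)%:E)).
  transitivity (\sum_(k \in range g) \int[m]_y (k * \1_(g @^-1` [set k]) y)%:E).
    under eq_integral do rewrite fimfunE -fsumEFin//.
    rewrite ge0_integral_fsum//.
    - by move=> k; apply/measurable_EFinP; exact: measurable_funM.
    - by move=> k x _; exact: nnfun_muleindic_ge0.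
  apply: eq_fsbigr => k /[!inE] -[y _ <-{k}].
  rewrite integralZl_indic_nnsfun// integral_indic// setIT mE//.
  under [RHS]eq_integral do rewrite EFinM -muleA.
  rewrite ge0_integralZl//.
  - congr (_ * _); rewrite integral_mkcond; apply: eq_integral => x _.
    rewrite patchE indicE (_ : (phi x \in _) = (x \in phi @^-1` (g @^-1` [set g y]))).
      by case: ifPn => _; rewrite ?mul1e ?mul0e.
    by apply/idP/idP; rewrite !inE.
  - apply: emeasurable_funM; apply/measurable_EFinP => //.
    exact: measurableT_comp.
  - by move=> x _; rewrite -EFinM lee_fin mulr_ge0.
  - by rewrite lee_fin.
transitivity (\int[mu]_x \sum_(k \in range g)
    ((k * \1_(g @^-1` [set k]) (phi x))%:E * (h x)%:E)); last first.
  apply: eq_integral => x _; rewrite [in RHS]fimfunE -fsumEFin// ge0_mule_fsuml//.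
  by move=> k; exact: nnfun_muleindic_ge0.
rewrite ge0_integral_fsum//.
- move=> k; apply: emeasurable_funM; apply/measurable_EFinP => //.
  by apply: measurable_funM => //; exact: measurableT_comp.
- move=> k x _; apply: mule_ge0; last by rewrite lee_fin.
  exact: nnfun_muleindic_ge0.
Qed.

(** Simple functions increase to [f], and monotone convergence passes to the limit on both sides. It
    serves twice: for the noise pair under a weighted probability, and with [phi] the identity and
    [h] the Gaussian density. *)
Lemma integral_pushforward_density (f : T' -> \bar R) :
  measurable_fun [set: T'] f -> (forall y, 0 <= f y) ->
  \int[m]_y f y = \int[mu]_x (f (phi x) * (h x)%:E).
Proof.
move=> mf f0; pose f_ := nnsfun_approx measurableT mf.
have f_f y : (f_ n y)%:E @[n --> \oo] --> f y.
  by apply: (@cvg_nnsfun_approx _ _ _ _ measurableT f mf).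
transitivity (limn (fun n => \int[m]_y (f_ n y)%:E)).
  rewrite -monotone_convergence//.
  - by apply: eq_integral => y _; apply/esym/cvg_lim => //; exact: f_f.
  - by move=> n; exact/measurable_EFinP/measurable_funP.
  - by move=> n y _; rewrite lee_fin.
  - by move=> y _ a b ab; rewrite lee_fin; exact/lefP/nd_nnsfun_approx.
under eq_fun do rewrite integral_pushforward_density_nnsfun.
rewrite -monotone_convergence//.
- apply: eq_integral => x _; apply/cvg_lim => //.
  by apply: cvgeZr => //; exact: f_f.
- move=> n; apply: emeasurable_funM; apply/measurable_EFinP => //.
  exact: measurableT_comp.
- by move=> n x _; rewrite -EFinM lee_fin mulr_ge0.
- move=> x _ a b ab; rewrite lee_wpmul2r ?lee_fin//; exact/lefP/nd_nnsfun_approx.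
Qed.
End density.

Section weighted_law.
Local Open Scope ereal_scope.
Context d d' (T : measurableType d) (T' : measurableType d') (R : realType).
Variables (mu : {measure set T -> \bar R}) (phi : T -> T') (h : T -> R).

(** The proofs are arguments because the measure structure attached below to this symbol depends on
    them. *)
Definition weighted_law of measurable_fun [set: T] phi
    & measurable_fun [set: T] h & (forall x, 0 <= h x)%R :=
  fun A : set T' => \int[mu]_(x in phi @^-1` A) (h x)%:E.

Hypothesis mphi : measurable_fun [set: T] phi.
Hypothesis mh : measurable_fun [set: T] h.
Hypothesis h0 : forall x, (0 <= h x)%R.
Local Notation law := (weighted_law mphi mh h0).

Let law0 : law set0 = 0.
Proof. by rewrite /weighted_law preimage_set0 integral_set0. Qed.

Let law_ge0 A : 0 <= law A.
Proof. by apply: integral_ge0 => x _; rewrite lee_fin. Qed.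

Let law_sigma_additive : semi_sigma_additive law.
Proof.
move=> F mF tF mUF; rewrite /weighted_law preimage_bigcup.
have mF' i : measurable (phi @^-1` F i) by rewrite -[X in measurable X]setTI; exact: mphi.
rewrite ge0_integral_bigcup//.
- apply: is_cvg_ereal_nneg_natsum_cond => n _ _.
  by apply: integral_ge0 => x _; rewrite lee_fin.
- by apply/measurable_EFinP; exact: measurable_funTS.
- by move=> x _; rewrite lee_fin.
- apply/trivIsetP => /= i j _ _ ij; rewrite -preimage_setI.
  by move/trivIsetP : tF => /(_ _ _ _ _ ij) ->//; rewrite preimage_set0.
Qed.

HB.instance Definition _ := isMeasure.Build _ _ _ law law0 law_ge0 law_sigma_additive.
End weighted_law.

Section independent.
Local Open Scope ereal_scope.
Context d d1 d2 (T : measurableType d) (T1 : measurableType d1)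
  (T2 : measurableType d2) (R : realType).
Variables (mu : {measure set T -> \bar R}).
Variables (m1 : {finite_measure set T1 -> \bar R}) (m2 : {finite_measure set T2 -> \bar R}).

(** Under the weight [h] the law of [(U, V)] agrees with [c m1 x m2] on rectangles, hence
    everywhere, and Tonelli gives the iterated integral. The constant [c] is the factor by which the
    weight changes the total mass. *)
Lemma integral_weighted_independent (U : T -> T1) (V : T -> T2) (h : T -> R)
    (c : {nonneg R}) (g : T1 * T2 -> \bar R) :
  measurable_fun setT U -> measurable_fun setT V -> measurable_fun setT h ->
  (forall x, 0 <= h x)%R ->
  (forall A B, measurable A -> measurable B ->
    \int[mu]_(x in U @^-1` A `&` V @^-1` B) (h x)%:E = c%:num%:E * (m1 A * m2 B)) ->
  measurable_fun setT g -> (forall z, 0 <= g z) ->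
  \int[mu]_x (g (U x, V x) * (h x)%:E) =
    c%:num%:E * \int[m1]_x \int[m2]_y g (x, y).
Proof.
move=> mU mV mh h0 UV mg g0.
have mUV : measurable_fun setT (fun x => (U x, V x)) by exact: measurable_fun_pair.
rewrite -(integral_pushforward_density (m := weighted_law mu mUV mh h0) mUV mh)//.
rewrite -(@eq_measure_integral _ _ _ _ _ (mscale c m1 \x m2)); last first.
  move=> A mA _; apply: product_measure_unique => // A1 A2 mA1 mA2.
  by rewrite /= /mscale/= -muleA -UV.
rewrite fubini_tonelli1// ge0_integral_mscale//.
- exact: measurable_fun_fubini_tonelli_F.
- by move=> x _; exact: integral_ge0.
Qed.
End independent.

(** * Moments of the standard normal law up to order four *)

Section gauss.
Variable R : realType.
Local Notation mu := (@lebesgue_measure R).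
Local Notation phi := (normal_pdf (0 : R) 1).

Lemma normal_pdf_centeredE (s x : R) : s != 0 ->
  normal_pdf 0 s x = normal_peak s * expR (- x ^+ 2 / (s ^+ 2 *+ 2)).
Proof. by move=> s0; rewrite normal_pdfE// /normal_fun subr0. Qed.

Lemma normal_pdf01E (x : R) : phi x = normal_peak 1 * expR (- (x ^+ 2 / 2)).
Proof. by rewrite normal_pdf_centeredE ?oner_eq0// expr1n mulNr. Qed.

Lemma exprn_le_expR (t : R) n : 0 <= t -> t ^+ n.+1 <= n.+1`!%:R * expR t.
Proof.
move=> t0; have f0 : 0 < n.+1`!%:R :> R by rewrite ltr0n fact_gt0.
rewrite mulrC -ler_pdivrMr//; apply: le_trans (expR_ge1Dxn n t0).
by rewrite lerDr.
Qed.

(** With [t = x^2 / 4], the density is proportional to [exp (- t)] squared: one factor absorbs the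
    power of [x], the other is a Gaussian of variance 2, already known to be integrable and
    bounded. *)
Lemma exprn_normal_pdf_le n : exists2 C : R, 0 <= C &
  forall x, `|x| ^+ n * phi x <= C * normal_pdf 0 (Num.sqrt 2) x.
Proof.
have s2 : Num.sqrt 2 != 0 :> R by rewrite gt_eqF// sqrtr_gt0.
have p2 : 0 < normal_peak (Num.sqrt 2 : R) by exact: normal_peak_gt0.
have p1 := normal_peak_ge0 (1 : R).
(* From [|x|^n <= 1 + (4 t)^(n+1)] and [t^(n+1) exp (- t) <= (n+1)!]. *)
pose K : R := 1 + 4 ^+ n.+1 * n.+1`!%:R.
have K0 : 0 <= K by rewrite addr_ge0// mulr_ge0// exprn_ge0.
exists (normal_peak 1 * K / normal_peak (Num.sqrt 2)).
  by rewrite divr_ge0 ?mulr_ge0// ltW.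
move=> x; rewrite normal_pdf01E normal_pdf_centeredE// sqr_sqrtr// mulNr.
rewrite [leRHS]mulrA divfK ?gt_eqF//.
set t := x ^+ 2 / 4; have t0 : 0 <= t by rewrite divr_ge0// sqr_ge0.
have -> : x ^+ 2 / 2 = t + t by rewrite /t; field.
have -> : x ^+ 2 / (2 *+ 2) = t by rewrite /t -mulrnA.
rewrite opprD expRD; set e := expR (- t).
have e0 : 0 <= e by exact: expR_ge0.
have -> : `|x| ^+ n * (normal_peak 1 * (e * e)) = normal_peak 1 * e * (`|x| ^+ n * e).
  by ring.
rewrite [leRHS]mulrAC ler_wpM2l ?mulr_ge0//.
  have xn : `|x| ^+ n <= 1 + (4 * t) ^+ n.+1.
    have -> : 4 * t = `|x| ^+ 2 by rewrite real_normK ?num_real// /t; field.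
    have [x1|x1] := leP `|x| 1.
      by rewrite (le_trans (exprn_ile1 _ (normr_ge0 x) x1))// lerDl exprn_ge0// exprn_ge0.
    rewrite -exprM (@le_trans _ _ (`|x| ^+ (2 * n.+1)))// ?lerDr//.
    by rewrite ler_weXn2l ?(ltW x1)//; apply: leq_trans (leqnSn n) _; rewrite leq_pmull.
  have e1 : e <= 1 by rewrite -expR0 ler_expR oppr_le0.
  apply: (le_trans (ler_wpM2r e0 xn)); rewrite mulrDl mul1r lerD//.
  rewrite exprMn -mulrA ler_wpM2l ?exprn_ge0//.
  apply: (le_trans (ler_wpM2r e0 (exprn_le_expR n t0))).
  by rewrite -mulrA -expRD subrr expR0 mulr1.
Qed.

Lemma continuous_normal_pdf01 : continuous phi.
Proof. by apply: continuous_normal_pdf; rewrite oner_eq0. Qed.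

Lemma continuous_exprn_normal_pdf n : continuous (fun x : R => x ^+ n * phi x).
Proof. by move=> x; apply: cvgM; [exact: exprn_continuous|exact: continuous_normal_pdf01]. Qed.

Lemma measurable_exprn_normal_pdf n : measurable_fun [set: R] (fun x : R => x ^+ n * phi x).
Proof. by apply: measurable_funM; [exact: exprn_measurable|exact: measurable_normal_pdf]. Qed.

Lemma integrable_exprn_normal_pdf n : mu.-integrable setT (EFin \o (fun x : R => x ^+ n * phi x)).
Proof.
have [C C0 hC] := exprn_normal_pdf_le n.
have iC := @integrableZl _ _ _ mu setT measurableT C _ (integrable_normal_pdf (0 : R) (Num.sqrt 2)).
apply: le_integrable iC => //.
  by apply/measurable_EFinP; exact: measurable_exprn_normal_pdf.
move=> x _ /=; rewrite lee_fin normrM normrX (ger0_norm (normal_pdf_ge0 _ _ _)).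
by apply: (le_trans (hC x)); rewrite ler_norm.
Qed.

Lemma is_derive_normal_pdf (x : R) : is_derive x 1 phi (- x * phi x).
Proof.
rewrite (_ : phi = fun x => normal_peak 1 * expR (- (x ^+ 2 / 2))); last first.
  by apply/funext => y; rewrite normal_pdf01E.
apply: is_derive_eq.
by rewrite /GRing.scale /= mulr0 mulr0 add0r !mulr1; field.
Qed.

Lemma is_derive_exprn_normal_pdf n (x : R) :
  is_derive x 1 (fun x => x ^+ n * phi x)
    (n%:R * (x ^+ n.-1 * phi x) - x ^+ n.+1 * phi x).
Proof.
have dphi := is_derive_normal_pdf x.
have dX : is_derive x 1 (fun y : R => y ^+ n) (n%:R * x ^+ n.-1).
  have := @is_deriveX R R id n x 1 1 (is_derive_id _ _).
  by rewrite exprfctE /GRing.scale/= mulr1 mulr_natl.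
have dM := @is_deriveM R R _ _ x 1 _ _ dX dphi.
apply: (@is_derive_eq _ _ _ _ _ _ _ _ dM).
rewrite /GRing.scale/= exprS; ring.
Qed.

(** The sign [s] treats both ends of the line together. Bounding one power more than needed leaves a
    factor [1 / (m + 1)], which gives the decay. *)
Lemma cvg_exprn_normal_pdf n (s : R) : `|s| = 1 ->
  (s * m.+1%:R) ^+ n * phi (s * m.+1%:R) @[m --> \oo] --> (0 : R).
Proof.
move=> s1; have [C C0 hC] := exprn_normal_pdf_le n.+1.
pose D := C * normal_peak (Num.sqrt 2).
have hD x : `|x| ^+ n.+1 * phi x <= D.
  apply: (le_trans (hC x)); apply: ler_wpM2l => //; apply: normal_pdf_ub.
  by rewrite gt_eqF// sqrtr_gt0.
apply/norm_cvg0P; apply: (@squeeze_cvgr _ _ _ _ (cst 0) (fun m => D * harmonic m)).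
- apply: nearW => m /=; rewrite normr_ge0/= normrM normrX normrM s1 mul1r.
  rewrite (ger0_norm (normal_pdf_ge0 _ _ _)) ler_pdivlMr// mulrAC.
  have := hD (s * m.+1%:R); rewrite normrM s1 mul1r exprSr.
  by rewrite [`|m.+1%:R|]ger0_norm.
- exact: cvg_cst.
- by rewrite -[X in _ --> X](mulr0 D); apply: cvgMr; exact: cvg_harmonic.
Qed.

(* The integrand is the derivative of [x^n phi x], which vanishes at infinity;
   this yields the moment recursion. *)
Lemma integral_derive_exprn_normal_pdf n :
  \int[mu]_x (n%:R * (x ^+ n.-1 * phi x) - x ^+ n.+1 * phi x) = 0.
Proof.
set f := (fun x => _).
have cf : continuous f.
  move=> x; apply: cvgB; last exact: continuous_exprn_normal_pdf.
  by apply: cvgM; [exact: cvg_cst|exact: continuous_exprn_normal_pdf].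
have if_ : mu.-integrable setT (EFin \o f).
  have i1 := @integrableZl _ _ _ mu setT measurableT n%:R _ (integrable_exprn_normal_pdf n.-1).
  exact: (@integrableB _ _ _ mu setT measurableT _ _ i1 (integrable_exprn_normal_pdf n.+1)).
(* Integrals over these intervals have two limits to be identified: 0, by the fundamental theorem
   and vanishing boundary terms, and the full integral, by dominated convergence with [|f|] as
   bound. *)
pose I m : set R := `[(- m.+1%:R), m.+1%:R]%classic.
have FTC m : (\int[mu]_(x in I m) (f x)%:E =
   (m.+1%:R ^+ n * phi m.+1%:R)%:E - ((- m.+1%:R) ^+ n * phi (- m.+1%:R))%:E)%E.
  rewrite (continuous_FTC2 (F := fun x : R => x ^+ n * phi x))//.
  - by rewrite gtrN.
  - exact: continuous_subspaceT.
  - split.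
    + move=> x _; exact: (@ex_derive _ _ _ _ _ _ _ (is_derive_exprn_normal_pdf n x)).
    + apply: cvg_at_right_filter; exact: continuous_exprn_normal_pdf.
    + apply: cvg_at_left_filter; exact: continuous_exprn_normal_pdf.
  - move=> x _; rewrite derive1E; exact: (@derive_val _ _ _ _ _ _ _ (is_derive_exprn_normal_pdf n x)).
have lim1 : (\int[mu]_(x in I m) (f x)%:E)%E @[m --> \oo] --> 0%E.
  under eq_fun do rewrite FTC.
  have hp : ((m.+1%:R ^+ n * phi m.+1%:R)%:E)%E @[m --> \oo] --> (0 : R)%:E.
    apply: cvg_EFin; first exact: nearW.
    have := @cvg_exprn_normal_pdf n 1 (normr1 _).
    by under eq_fun do rewrite mul1r.
  have hn : (((- m.+1%:R) ^+ n * phi (- m.+1%:R))%:E)%E @[m --> \oo] --> (0 : R)%:E.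
    apply: cvg_EFin; first exact: nearW.
    have := @cvg_exprn_normal_pdf n (-1) (normrN1 _).
    by under eq_fun do rewrite mulN1r.
  have ad : (0%:E +? - (0 : R)%:E)%E by [].
  by have := cvgeB ad hp hn; rewrite sube0; apply.
have lim2 : (\int[mu]_(x in I m) (f x)%:E)%E @[m --> \oo] --> (\int[mu]_x (f x)%:E)%E.
  under eq_fun do rewrite integral_mkcond.
  have [] := @dominated_convergence _ _ _ mu setT measurableT
    (fun m => (EFin \o f) \_ (I m)) (EFin \o f) (fun x => `|(EFin \o f) x|%E).
  - move=> m; apply/(measurable_restrictT _ _).1 => //; first exact: measurable_itv.
    by apply: measurable_funTS; exact: measurable_int if_.
  - exact: measurable_int if_.
  - apply: aeW => x _; apply: cvg_near_cst; exists (Num.truncn `|x|).+1 => // m /= xm.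
    rewrite patchE mem_set//= /I/= in_itv/= -ler_norml.
    by rewrite (le_trans (ltW (truncnS_gt _)))// ler_nat (leq_trans xm).
  - exact: (@integrable_abse _ _ _ mu _ _ if_).
  - apply: aeW => x m _; rewrite patchE; case: ifPn => _ //.
    by rewrite abse0.
  - by move=> _ _; apply.
rewrite /Rintegral; have <- := cvg_unique _ lim1 lim2; first by [].
exact: ereal_hausdorff.
Qed.
Let M n := \int[mu]_x (x ^+ n * phi x).

(** For [n = 0] the predecessor is 0 by convention, but the factor [n%:R] vanishes, so the rule
    correctly gives [M 1 = 0]. *)
Let M_rec n : M n.+1 = n%:R * M n.-1.
Proof.
have := integral_derive_exprn_normal_pdf n.
rewrite RintegralB//; last 2 first.
- exact: (@integrableZl _ _ _ mu setT measurableT n%:R _ (integrable_exprn_normal_pdf n.-1)).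
- exact: integrable_exprn_normal_pdf.
rewrite RintegralZl//; last exact: integrable_exprn_normal_pdf.
by move/eqP; rewrite subr_eq0 => /eqP h; exact: (esym h).
Qed.

Lemma normal_moments :
  [/\ M 0 = 1, M 1 = 0, M 2 = 1, M 3 = 0 & M 4 = 3].
Proof.
have M0 : M 0 = 1.
  rewrite /M /Rintegral; under eq_integral do rewrite expr0 mul1r.
  by rewrite integral_normal_pdf.
have M1 : M 1 = 0 by rewrite M_rec mul0r.
have M2 : M 2 = 1 by rewrite M_rec M0 mul1r.
have M3 : M 3 = 0 by rewrite M_rec M1 mulr0.
by split=> //; rewrite M_rec M2 mulr1.
Qed.

(** Nonnegativity of [p] gives access to the density formula; the moments 1, 0, 1, 0, 3 then give
    the value. *)
Lemma integral_normal_prob_quartic (k0 k1 k2 k3 k4 : R) :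
  let p x := k0 + k1 * x + k2 * x ^+ 2 + k3 * x ^+ 3 + k4 * x ^+ 4 in
  (forall x, 0 <= p x) ->
  (\int[normal_prob 0 1]_x (p x)%:E = (k0 + k2 + 3 * k4)%:E)%E.
Proof.
move=> p p0.
have cp : measurable_fun [set: R] p.
  by rewrite /p; do ?[apply: measurable_funD|apply: measurable_funM] => //; exact: exprn_measurable.
rewrite (@integral_pushforward_density _ _ _ _ R mu _ id phi)//; last 3 first.
- exact: measurable_normal_pdf.
- by move=> x; exact: normal_pdf_ge0.
- exact/measurable_EFinP.
have [M0 M1 M2 M3 M4] := normal_moments.
pose q n k x : R := k * (x ^+ n * phi x).
have iq n k : mu.-integrable setT (EFin \o q n k).
  exact: (@integrableZl _ _ _ mu setT measurableT k _ (integrable_exprn_normal_pdf n)).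
have iD (f g : R -> R) : mu.-integrable setT (EFin \o f) -> mu.-integrable setT (EFin \o g) ->
    mu.-integrable setT (EFin \o (fun x => f x + g x)).
  by move=> f1 g1; exact: (@integrableD _ _ _ mu setT measurableT _ _ f1 g1).
have E x : ((p x)%:E * (phi x)%:E)%E =
   (q 0 k0 x + (q 1 k1 x + (q 2 k2 x + (q 3 k3 x + q 4 k4 x))))%:E.
  by rewrite -EFinM; congr EFin; rewrite /q /p; ring.
under eq_integral do rewrite E.
have i34 := iD _ _ (iq 3 k3) (iq 4 k4).
have i234 := iD _ _ (iq 2 k2) i34.
have i1234 := iD _ _ (iq 1 k1) i234.
have itot := iD _ _ (iq 0 k0) i1234.
have RD f g if_ ig := @RintegralD _ _ R mu setT f g measurableT if_ ig.
have RZ n k : \int[mu]_x q n k x = k * M n.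
  exact: (RintegralZl _ measurableT (integrable_exprn_normal_pdf n)).
rewrite -[LHS]fineK; last exact: (integrable_fin_num measurableT itot).
congr EFin; apply: (etrans (RD _ _ (iq 0 k0) i1234)).
apply: (etrans (congr2 +%R (RZ _ _) (RD _ _ (iq 1 k1) i234))).
rewrite (RD _ _ (iq 2 k2) i34) (RD _ _ (iq 3 k3) (iq 4 k4)) !RZ.
by rewrite M0 M1 M2 M3 M4; ring.
Qed.
End gauss.

(** * Products of independent factors *)

Section iid_product.
Local Open Scope ereal_scope.
Context d (Omega : measurableType d) (R : realType) (P : probability Omega R).
Variables (Zx Zy : nat -> {RV P >-> R}).
Hypothesis hZ : iid_standard_normal Zx Zy.
Variables (g : R * R -> R) (kappa : R) (Y : nat -> Omega -> R).
Hypothesis mg : measurable_fun [set: R * R] g.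
Hypothesis g0 : forall z, (0 <= g z)%R.
Hypothesis kappa0 : (0 <= kappa)%R.
Local Notation N := (normal_prob (0 : R) 1).
Hypothesis gE : \int[N]_x \int[N]_y (g (x, y))%:E = kappa%:E.
Hypothesis Y0 : forall w, Y 0%N w = 1%R.
Hypothesis YS : forall n w, Y n.+1 w = (g (Zx n w, Zy n w) * Y n w)%R.

Let Z := joint_noise Zx Zy.
Let time (i : nat + nat) : nat := match i with inl n => n | inr n => n end.
Let cyl (s : seq (nat + nat)) (B : nat + nat -> set R) : set Omega :=
  \bigcap_(i in [set` s]) Z i @^-1` B i.

Let Y_ge0 n w : (0 <= Y n w)%R.
Proof. by elim: n => [|n IH]; rewrite ?Y0// YS mulr_ge0. Qed.

(** [Y] is an arbitrary family of functions, so measurability has to be drawn from the recursion. *)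
Let mY n : measurable_fun [set: Omega] (Y n).
Proof.
elim: n => [|n IH].
  by rewrite (_ : Y 0%N = cst 1%R); [exact: measurable_cst | apply/funext => w; rewrite Y0].
rewrite (_ : Y n.+1 = (fun w => g (Zx n w, Zy n w) * Y n w)%R); last first.
  by apply/funext => w; rewrite YS.
apply: measurable_funM => //; apply: (measurableT_comp mg).
by apply: measurable_fun_pair; exact: measurable_funPT.
Qed.

Let cyl_cons i s B : cyl (i :: s) B = Z i @^-1` B i `&` cyl s B.
Proof.
apply/seteqP; split => w.
  move=> h; split; first by apply: h; rewrite /= inE eqxx.
  by move=> j /= js; apply: h; rewrite /= inE js orbT.
by move=> [h1 h2] j; rewrite /= inE => /predU1P[->//|js]; exact: h2.
Qed.

Let mcyl s B : (forall i, measurable (B i)) -> measurable (cyl s B).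
Proof.
move=> mB; elim: s => [|i s IH].
  by rewrite (_ : cyl _ _ = setT)//; apply/seteqP; split => // w _ i.
rewrite cyl_cons; apply: measurableI => //.
by rewrite -[X in measurable X]setTI; exact: measurable_funPT.
Qed.

Let law i (A : set R) : measurable A -> P (Z i @^-1` A) = N A.
Proof. by move=> mA; rewrite -(hZ.1 i A mA). Qed.

(* Cylinders over future noises carry along the independence of [Y n] from
   [(Zx n, Zy n)], which the induction step consumes. *)
Lemma integral_iid_product_cylinder n (s : seq (nat + nat)) (B : nat + nat -> set R) :
  uniq s -> all (fun i => n <= time i)%N s -> (forall i, measurable (B i)) ->
  \int[P]_(w in cyl s B) (Y n w)%:E =
    (kappa ^+ n * \prod_(i <- s) fine (N (B i)))%:E.
Proof.
elim: n s B => [|n IH] s B us ts mB.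
  under eq_integral do rewrite Y0.
  rewrite integral_cst ?mul1e ?expr0 ?mul1r; last exact: mcyl.
  rewrite [LHS](hZ.2 s B us mB) -prodEFin; apply: eq_bigr => i _.
  rewrite fineK; [exact: law|apply: fin_num_measure; exact: mB].
pose c := (kappa ^+ n * \prod_(i <- s) fine (N (B i)))%R.
have c0 : (0 <= c)%R.
  rewrite mulr_ge0 ?exprn_ge0// prodr_ge0// => i _.
  by rewrite fine_ge0// measure_ge0.
(* The cylinder is folded into the weight, so that only the noise pair of time [n] remains to be
   integrated. *)
pose h := Y n \_ (cyl s B).
have h0 w : (0 <= h w)%R by rewrite /h patchE; case: ifP.
have mh : measurable_fun [set: Omega] h.
  by apply/(measurable_restrictT _ _).1; [exact: mcyl|exact: measurable_funTS].
have notin j : time j = n -> j \notin s.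
  by move=> jn; apply/negP => /(allP ts); rewrite jn ltnn.
transitivity (\int[P]_w ((g (Zx n w, Zy n w))%:E * (h w)%:E)).
  rewrite integral_mkcond; apply: eq_integral => w _.
  by rewrite /h !patchE; case: ifP => _; rewrite ?mule0// YS EFinM.
rewrite (@integral_weighted_independent _ _ _ _ _ _ R P N N (Zx n) (Zy n) h
    (NngNum c0) (EFin \o g))//.
- by rewrite gE -EFinM /c/= exprSr; congr EFin; ring.
- by move=> mD A mA; exact: (@measurable_funPT _ _ _ _ (Zx n) mD A mA).
- by move=> mD A mA; exact: (@measurable_funPT _ _ _ _ (Zy n) mD A mA).
- move=> A1 A2 mA1 mA2.
  (* Since [s] contains only times after [n], both noises of time [n] can join the cylinder,
     constrained to [A1] and [A2]. The induction hypothesis for this longer list is the required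
     identity on rectangles. *)
  pose B' i := if i == inl n then A1 else if i == inr n then A2 else B i.
  have mB' i : measurable (B' i).
    rewrite /B'; case: ifP => _; first exact: mA1.
    by case: ifP => _; [exact: mA2|exact: mB].
  have Bs i : i \in s -> B' i = B i.
    move=> si; rewrite /B'; case: eqVneq => [E|_]; last case: eqVneq => [E|//].
      by move: si; rewrite E (negbTE (notin _ _)).
    by move: si; rewrite E (negbTE (notin _ _)).
  have B1 : B' (inl n) = A1 by rewrite /B' eqxx.
  have B2 : B' (inr n) = A2 by rewrite /B' eqxx.
  have cylE : cyl s B' = cyl s B by apply: eq_bigcapr => i si; rewrite Bs.
  have := IH [:: inl n, inr n & s] B'; rewrite !cyl_cons cylE B1 B2 => IHs.
  transitivity (\int[P]_(x in Z (inl n) @^-1` A1 `&`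
      (Z (inr n) @^-1` A2 `&` cyl s B)) (Y n x)%:E).
    rewrite setIA [RHS]integral_mkcondr; apply: eq_integral => w _.
    by rewrite /h restrict_EFin.
  rewrite IHs//; last 2 first.
  + by rewrite /= !inE /= !notin.
  + by rewrite /= leqnn /=; apply: sub_all ts => i; exact: ltnW.
  rewrite !big_cons /= [in LHS](eq_big_seq (fun i => fine (N (B i)))); last first.
    by move=> i si; rewrite Bs.
  rewrite B1 B2.
  rewrite -[N A1]fineK ?fin_num_measure// -[N A2]fineK ?fin_num_measure//.
  by rewrite -!EFinM /c; congr EFin; ring.
- by apply/measurable_EFinP.
Qed.

Lemma expectation_iid_product n : \int[P]_w (Y n w)%:E = (kappa ^+ n)%:E.
Proof.
have := @integral_iid_product_cylinder n [::] (fun=> setT) isT isT (fun=> measurableT).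
by rewrite big_nil mulr1 (_ : cyl _ _ = setT)//; apply/seteqP; split => // w _ i.
Qed.

End iid_product.

(** * The amplification factor *)

Section amplification.
Variable R : realType.

(** [alpha x + beta y] is centred Gaussian with variance [alpha^2 + beta^2], so its fourth moment is
    three times the squared variance. The law of the sum is not invoked: a quartic in [y], then one
    in [x], is integrated. *)
Lemma integral_normal_square_quartic (alpha beta c r : R) : 0 <= c -> 0 <= r ->
  (\int[normal_prob (0 : R) 1]_x \int[normal_prob (0 : R) 1]_y
    (r * (1 + c + (c - (alpha * x + beta * y) ^+ 2) ^+ 2 / 4))%:E =
  (r * (1 + c + (c ^+ 2 - 2 * c * (alpha ^+ 2 + beta ^+ 2)
    + 3 * (alpha ^+ 2 + beta ^+ 2) ^+ 2) / 4))%:E)%E.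
Proof.
move=> c0 r0.
have pos t : 0 <= r * (1 + c + (c - t) ^+ 2 / 4).
  by rewrite mulr_ge0// addr_ge0 ?addr_ge0// divr_ge0 ?sqr_ge0.
pose q (x : R) := r * (1 + c + c ^+ 2 / 4 - c * beta ^+ 2 / 2 + 3 * beta ^+ 4 / 4)
   + 0 * x + r * (3 * alpha ^+ 2 * beta ^+ 2 / 2 - c * alpha ^+ 2 / 2) * x ^+ 2
   + 0 * x ^+ 3 + r * (alpha ^+ 4 / 4) * x ^+ 4.
have inner x : (\int[normal_prob (0 : R) 1]_y
    (r * (1 + c + (c - (alpha * x + beta * y) ^+ 2) ^+ 2 / 4))%:E = (q x)%:E)%E.
  pose s := alpha * x.
  have E y : r * (1 + c + (c - (alpha * x + beta * y) ^+ 2) ^+ 2 / 4) =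
      r * (1 + c + (c - s ^+ 2) ^+ 2 / 4) + r * (beta * s * (s ^+ 2 - c)) * y
      + r * (beta ^+ 2 * (3 * s ^+ 2 - c) / 2) * y ^+ 2
      + r * (s * beta ^+ 3) * y ^+ 3 + r * (beta ^+ 4 / 4) * y ^+ 4.
    by rewrite /s; field.
  under eq_integral do rewrite E.
  rewrite integral_normal_prob_quartic; last by move=> y; rewrite -E.
  by congr EFin; rewrite /q /s; field.
under eq_integral do rewrite inner.
rewrite integral_normal_prob_quartic; first by congr EFin; field.
(* The sign of [q] is hard to see on its coefficients; it is inherited from the integral that [q]
   equals. *)
move=> x; rewrite -[leRHS]/(q x) -lee_fin -inner.
by apply: integral_ge0 => y _; rewrite lee_fin.
Qed.

(** Replacing [a^2], [b^2] by their bounds and [2 a b rho] by [c |rho|] leaves a polynomial in [u]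
    and [v]. Its [u^2] and [v^2] coefficients are the left sides of two hypotheses, to be compared
    with 1; its [u v] coefficient is twice that of the third, hence below 2, to be compared with
    4. *)
Lemma amplification_lt (rx ry rho u v a b c s : R) :
  0 <= rx < 1 -> 0 <= ry < 1 ->
  2 * rx ^+ 2 * (1 + 2 * `|rho|) < 1 -> 2 * ry ^+ 2 * (1 + 2 * `|rho|) < 1 ->
  2 * rx * ry * (3 * rho ^+ 2 + 2 * `|rho| + 1) < 1 ->
  0 <= u -> 0 <= v -> 0 < u + v ->
  a ^+ 2 <= 2 * rx * u -> b ^+ 2 <= 2 * ry * v ->
  c = a ^+ 2 + b ^+ 2 -> s = c + 2 * a * b * rho ->
  1 + c + (c ^+ 2 - 2 * c * s + 3 * s ^+ 2) / 4 < (1 + u) ^+ 2 * (1 + v) ^+ 2.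
Proof.
move=> /andP[rx0 rx1] /andP[ry0 ry1] + + + u0 v0 uv au bv; set r := `|rho|.
move=> hx2 hy2 hxy cE sE0.
have r0 : 0 <= r by exact: normr_ge0.
have rr : rho ^+ 2 = r ^+ 2 by rewrite /r real_normK ?num_real.
have p0 : 0 <= a ^+ 2 by exact: sqr_ge0.
have q0 : 0 <= b ^+ 2 by exact: sqr_ge0.
rewrite rr in hxy.
have sE : 1 + c + (c ^+ 2 - 2 * c * s + 3 * s ^+ 2) / 4 =
    1 + c + c ^+ 2 / 2 + c * (2 * (a * b) * rho) + 3 * (a ^+ 2 * b ^+ 2) * r ^+ 2.
  by rewrite -rr sE0 cE; field.
have c0 : 0 <= c by rewrite cE addr_ge0.
(* The sign of [a b] is unknown, hence the absolute value of [rho]; [2 |a b| <= c] is the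
   arithmetic-geometric mean inequality. *)
have abr : 2 * (a * b) * rho <= c * r.
  have : `|2 * (a * b)| <= c.
    have := sqr_ge0 (a - b); have := sqr_ge0 (a + b); rewrite cE ler_norml.
    move=> h1 h2; apply/andP; split; lra.
  move=> h; rewrite (le_trans (ler_norm _))// normrM -/r.
  exact: ler_wpM2r.
have cr := ler_wpM2l c0 abr.
pose p := a ^+ 2; pose q := b ^+ 2; rewrite -/p -/q in p0 q0 au bv sE cE.
set P := 2 * rx * u in au; set Q := 2 * ry * v in bv.
have P0 : 0 <= P by rewrite !mulr_ge0.
have Q0 : 0 <= Q by rewrite !mulr_ge0.
have cPQ : c <= P + Q by rewrite cE lerD.
have c2 : c ^+ 2 <= (P + Q) ^+ 2 by rewrite lerXn2r ?nnegrE ?addr_ge0.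
have pq : p * q <= P * Q by exact: ler_pM.
have r2 : 0 <= r ^+ 2 by exact: sqr_ge0.
have c2r := ler_wpM2r r0 c2.
have pqr := ler_wpM2r r2 pq.
have ub : 1 + c + (c ^+ 2 - 2 * c * s + 3 * s ^+ 2) / 4 <=
   1 + (P + Q) + (P + Q) ^+ 2 / 2 + (P + Q) ^+ 2 * r + 3 * (P * Q * r ^+ 2).
  rewrite sE; have : c * (c * r) = c ^+ 2 * r by ring.
  by lra.
apply: (le_lt_trans ub).
have hu := ler_wpM2r (sqr_ge0 u) (ltW hx2).
have hv := ler_wpM2r (sqr_ge0 v) (ltW hy2).
have huv := ler_wpM2r (mulr_ge0 u0 v0) (ltW hxy).
(* Strictness may come from one direction only: from [rx < 1] when [u > 0], otherwise from [ry < 1],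
   as then [v > 0]. *)
have lin : P + Q < 2 * u + 2 * v.
  have [u1|u1] := eqVneq u 0.
    have v1 : 0 < v by lra.
    rewrite /P /Q u1 mulr0 add0r mulr0 add0r ltr_pM2r//; lra.
  have u2 : 0 < u by rewrite lt_def u1.
  apply: ltr_leD; first by rewrite /P ltr_pM2r//; lra.
  by rewrite /Q ler_wpM2r//; lra.
have E : (P + Q) ^+ 2 / 2 + (P + Q) ^+ 2 * r + 3 * (P * Q * r ^+ 2) =
    2 * rx ^+ 2 * (1 + 2 * r) * u ^+ 2 + 2 * ry ^+ 2 * (1 + 2 * r) * v ^+ 2
    + 2 * (2 * rx * ry * (3 * r ^+ 2 + 2 * r + 1) * (u * v)).
  by rewrite /P /Q; field.
have := mulr_ge0 u0 v0.
have := mulr_ge0 (mulr_ge0 u0 v0) (addr_ge0 u0 v0).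
have := sqr_ge0 (u * v).
have -> : (1 + u) ^+ 2 * (1 + v) ^+ 2 = 1 + 2 * u + 2 * v + u ^+ 2 + v ^+ 2
   + 4 * (u * v) + 2 * (u * v * (u + v)) + (u * v) ^+ 2 by ring.
by lra.
Qed.

Lemma sqr_normc (x : R[i]) : Normc.normc x ^+ 2 = complex.Re x ^+ 2 + complex.Im x ^+ 2.
Proof. by case: x => a b /=; rewrite sqr_sqrtr// addr_ge0 ?sqr_ge0. Qed.

(** With [S = a zx + b zy], the second-order terms and the mixed one assemble into a square and the
    symbol is [1 + (c - S^2) / 2 - i S]. In its squared modulus the [- S^2] from the real part
    cancels the [S^2] from the imaginary part. *)
Lemma sqr_normc_explicit_symbol (hx hy rhox rhoy k zx zy xi eta : R) :
  0 <= rhox -> 0 <= rhoy -> 0 < k ->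
  let a := Num.sqrt (rhox * k) * (sin (xi * hx) / hx) in
  let b := Num.sqrt (rhoy * k) * (sin (eta * hy) / hy) in
  let c := a ^+ 2 + b ^+ 2 in
  Normc.normc (explicit_symbol hx hy rhox rhoy k zx zy xi eta) ^+ 2 =
  1 + c + (c - (a * zx + b * zy) ^+ 2) ^+ 2 / 4.
Proof.
move=> rx0 ry0 k0 a b c; rewrite sqr_normc /explicit_symbol /=.
set sx := sin (xi * hx) / hx; set sy := sin (eta * hy) / hy.
have aE : a = Num.sqrt (rhox * k) * sx by [].
have bE : b = Num.sqrt (rhoy * k) * sy by [].
have ea : rhox * k * sx ^+ 2 = a ^+ 2.
  by rewrite aE [in RHS]exprMn sqr_sqrtr// mulr_ge0// ltW.
have eb : rhoy * k * sy ^+ 2 = b ^+ 2.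
  by rewrite bE [in RHS]exprMn sqr_sqrtr// mulr_ge0// ltW.
have eab : Num.sqrt (rhox * rhoy) * k * sx * sy = a * b.
  have -> : a * b = (Num.sqrt (rhox * k) * Num.sqrt (rhoy * k)) * sx * sy.
    by rewrite aE bE; ring.
  rewrite -sqrtrM ?mulr_ge0 ?(ltW k0)//.
  have -> : rhox * k * (rhoy * k) = (rhox * rhoy) * k ^+ 2 by ring.
  by rewrite (sqrtrM (k ^+ 2)) ?mulr_ge0// sqrtr_sqr gtr0_norm.
have -> : 1 - rhox * k * (zx ^+ 2 - 1) / 2 * sx ^+ 2
   - rhoy * k * (zy ^+ 2 - 1) / 2 * sy ^+ 2
   - Num.sqrt (rhox * rhoy) * k * zx * zy * sx * sy =
   1 - (rhox * k * sx ^+ 2) * (zx ^+ 2 - 1) / 2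
   - (rhoy * k * sy ^+ 2) * (zy ^+ 2 - 1) / 2
   - (Num.sqrt (rhox * rhoy) * k * sx * sy) * zx * zy by ring.
rewrite ea eb eab.
have -> : Num.sqrt (rhox * k) * zx * sx + Num.sqrt (rhoy * k) * zy * sy = a * zx + b * zy.
  by rewrite aE bE; ring.
by rewrite /c; field.
Qed.

(** The drift enters only the imaginary part; dropping that part gives a bound uniform in [mu]. *)
Lemma sqr_normc_implicit_symbol_ge (mu h k t : R) : 0 < h -> 0 < k ->
  (1 + k / h ^+ 2 * (1 - cos (t * h))) ^+ 2 <= Normc.normc (implicit_symbol mu h k t) ^+ 2.
Proof. by move=> h0 k0; rewrite sqr_normc /= lerDl sqr_ge0. Qed.

Lemma cos_lt1_of_box (h t : R) : 0 < h -> `|t| <= pi / h -> t != 0 -> cos (t * h) < 1.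
Proof.
move=> h0 th t0; rewrite -cos_norm normrM (gtr0_norm h0) -cos0.
have t1 : 0 < `|t| * h by rewrite mulr_gt0// normr_gt0.
have pi0 := pi_ge0 R.
rewrite ltr_cos ?in_itv//= ?lexx ?pi0//.
by rewrite (ltW t1)/= -ler_pdivlMr.
Qed.

(** [sin^2 = (1 - cos) (1 + cos)], and the factor 2 bounds [1 + cos]. *)
Lemma sqr_explicit_le (rho h k t : R) : 0 <= rho -> 0 < h -> 0 < k ->
  (Num.sqrt (rho * k) * (sin (t * h) / h)) ^+ 2 <=
    2 * rho * (k / h ^+ 2 * (1 - cos (t * h))).
Proof.
move=> r0 h0 k0; rewrite exprMn sqr_sqrtr ?mulr_ge0 ?(ltW k0)//.
have E := sin2cos2 (t * h).
rewrite expr_div_n E.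
have -> : rho * k * ((1 - cos (t * h) ^+ 2) / h ^+ 2) =
   rho * (k / h ^+ 2 * (1 - cos (t * h))) * (1 + cos (t * h)).
  by field; rewrite gt_eqF.
have -> : 2 * rho * (k / h ^+ 2 * (1 - cos (t * h))) =
   rho * (k / h ^+ 2 * (1 - cos (t * h))) * 2 by ring.
have c1 := cos_le1 (t * h).
apply: ler_wpM2l; last by lra.
rewrite !mulr_ge0 ?subr_ge0// ?(ltW k0)// invr_ge0 exprn_ge0// ltW//.
Qed.

End amplification.

Theorem proposition3p1 (R : realType) (d : measure_display)
  (Omega : measurableType d) (P : probability Omega R)
  (Zx Zy : nat -> {RV P >-> R})
  (mux muy rhox rhoy rhoxy : R) (i0 j0 : int)
  (hZ : iid_standard_normal Zx Zy)
  (hrhox : 0 <= rhox < 1) (hrhoy : 0 <= rhoy < 1)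
  (hrhoxy : -1 <= rhoxy <= 1)
  (hx2 : 2 * rhox ^+ 2 * (1 + 2 * `|rhoxy|) < 1)
  (hy2 : 2 * rhoy ^+ 2 * (1 + 2 * `|rhoxy|) < 1)
  (hxy : 2 * rhox * rhoy * (3 * rhoxy ^+ 2 + 2 * `|rhoxy| + 1) < 1) :
  forall hx hy k : R, 0 < hx -> 0 < hy -> 0 < k ->
  forall (V : nat -> Omega -> grid R) (X : nat -> Omega -> R -> R -> R[i]),
    (forall w, is_ADI_solution mux muy rhox rhoy rhoxy hx hy k i0 j0
       (fun n => Zx n w) (fun n => Zy n w) (fun n => V n w)) ->
    (forall n w, is_fourier_transform hx hy i0 j0 (V n w) (X n w)) ->
    (forall w xi eta, frequency_box hx hy (xi, eta) -> X 0%N w xi eta = 1) ->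
  forall xi eta : R,
    frequency_box hx hy (xi, eta) -> (xi, eta) <> (0, 0) ->
    'E_P[fun w => (Normc.normc (X n w xi eta) ^+ 2)%R]%E @[n --> \oo] --> 0%E.
Proof.
move=> hx hy k hx0 hy0 k0 V X VS XF X0 xi eta box nz.
have [rx0 rx1] := andP hrhox; have [ry0 ry1] := andP hrhoy.
pose a := Num.sqrt (rhox * k) * (sin (xi * hx) / hx).
pose b := Num.sqrt (rhoy * k) * (sin (eta * hy) / hy).
pose c := a ^+ 2 + b ^+ 2.
(* Coefficients of [S] in the independent noises, once the correlated one is expanded. *)
pose alpha := a + b * rhoxy; pose beta := b * Num.sqrt (1 - rhoxy ^+ 2).
pose u := k / hx ^+ 2 * (1 - cos (xi * hx)).
pose v := k / hy ^+ 2 * (1 - cos (eta * hy)).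
pose D := Normc.normc (implicit_symbol mux hx k xi) ^+ 2 *
  Normc.normc (implicit_symbol muy hy k eta) ^+ 2.
have khx : 0 < k / hx ^+ 2 by rewrite divr_gt0// exprn_gt0.
have khy : 0 < k / hy ^+ 2 by rewrite divr_gt0// exprn_gt0.
have u0 : 0 <= u by rewrite mulr_ge0 ?(ltW khx)// subr_ge0 cos_le1.
have v0 : 0 <= v by rewrite mulr_ge0 ?(ltW khy)// subr_ge0 cos_le1.
have uv : 0 < u + v.
  case: box; rewrite /= !in_itv/= -!ler_norml => bx be.
  have [xi0|xi0] := eqVneq xi 0; last first.
    by rewrite ltr_wpDr// mulr_gt0// subr_gt0 (cos_lt1_of_box hx0 bx).
  have [eta0|eta0] := eqVneq eta 0; first by case: nz; rewrite xi0 eta0.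
  by rewrite ltr_wpDl// mulr_gt0// subr_gt0 (cos_lt1_of_box hy0 be).
have DE : (1 + u) ^+ 2 * (1 + v) ^+ 2 <= D.
  by apply: ler_pM; rewrite ?sqr_ge0//; exact: sqr_normc_implicit_symbol_ge.
have D0 : 0 < D.
  by apply: lt_le_trans DE; rewrite mulr_gt0// exprn_gt0// ltr_wpDr.
have c0 : 0 <= c by rewrite addr_ge0 ?sqr_ge0.
have rho1 : 0 <= 1 - rhoxy ^+ 2.
  have [lo hi] := andP hrhoxy.
  have -> : 1 - rhoxy ^+ 2 = (1 - rhoxy) * (1 + rhoxy) by ring.
  by apply: mulr_ge0; lra.
have sE : alpha ^+ 2 + beta ^+ 2 = c + 2 * a * b * rhoxy.
  by rewrite /beta exprMn sqr_sqrtr// /alpha /c; ring.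
pose kappa := D^-1 * (1 + c + (c ^+ 2 - 2 * c * (alpha ^+ 2 + beta ^+ 2)
    + 3 * (alpha ^+ 2 + beta ^+ 2) ^+ 2) / 4).
have kappa0 : 0 <= kappa.
  rewrite mulr_ge0 ?invr_ge0 ?(ltW D0)//.
  set s := _ + beta ^+ 2.
  have := sqr_ge0 (c - s); have : 0 <= s by rewrite addr_ge0 ?sqr_ge0.
  have := sqr_ge0 s.
  have -> : c ^+ 2 - 2 * c * s + 3 * s ^+ 2 = (c - s) ^+ 2 + 2 * s ^+ 2 by ring.
  by lra.
have kappa1 : kappa < 1.
  rewrite /kappa mulrC ltr_pdivrMr// mul1r; apply: lt_le_trans DE.
  apply: (amplification_lt hrhox hrhoy hx2 hy2 hxy u0 v0 uv _ _ (erefl c) sE).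
    exact: sqr_explicit_le.
  exact: sqr_explicit_le.
(* The random ratio of consecutive squared moduli; [kappa] is its mean. *)
pose g (z : R * R) := D^-1 *
  (1 + c + (c - (alpha * z.1 + beta * z.2) ^+ 2) ^+ 2 / 4).
pose Y n w := Normc.normc (X n w xi eta) ^+ 2.
have Y0 w : Y 0%N w = 1 by rewrite /Y X0// Normc.normc1 expr1n.
have YS n w : Y n.+1 w = g (Zx n w, Zy n w) * Y n w.
  have [_ _ /(_ n) step] := VS w.
  have := multiplier_recursion hx0 hy0 (XF n w) (XF n.+1 w) step box.
  move/(congr1 (fun z => Normc.normc z ^+ 2)).
  rewrite !Normc.normcM !exprMn mulrA -/D sqr_normc_explicit_symbol// -/a -/b -/c.
  have -> : a * Zx n w + b * correlated rhoxy (Zx n w) (Zy n w) =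
     alpha * Zx n w + beta * Zy n w.
    by rewrite /correlated /alpha /beta; ring.
  rewrite -!/(Y _ _) => DY.
  by rewrite /g -mulrA -DY mulKf// gt_eqF.
have g0 z : 0 <= g z.
  apply: mulr_ge0; first by rewrite invr_ge0 ltW.
  apply: addr_ge0; first exact: addr_ge0.
  by apply: divr_ge0 => //; exact: sqr_ge0.
have mg : measurable_fun [set: R * R] g.
  apply: measurable_funM => //; apply: measurable_funD => //.
  apply: measurable_funM => //; apply: measurable_funX; apply: measurable_funB => //.
  apply: measurable_funX; apply: measurable_funD; apply: measurable_funM => //.
have r0 : 0 <= D^-1 by rewrite invr_ge0 ltW.
have gE := integral_normal_square_quartic alpha beta c0 r0.
have EY n := expectation_iid_product hZ mg g0 kappa0 gE Y0 YS n.
rewrite (_ : (fun n => _) = (fun n => (kappa ^+ n)%:E)); last first.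
  by apply/funext => n; rewrite unlock EY.
apply: cvg_EFin; first exact: nearW.
by apply: cvg_expr; rewrite ger0_norm.
Qed.
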